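(* There is an $e\in\mathbb{N}$ such that there is a knowing machine which satisfies $\Sigma_e$, where $\Sigma_e$ is the set of axioms of a knowing machine along with the schema $K(K(\phi)\leftrightarrow\ulcorner\phi\urcorner\in W_e)$. In words: there is a knowing machine with Knowledge of having Gödel number $e$.
   Context: Language. Let $\mathscr{L}$ be the first-order language of Peano Arithmetic ($PA$). The first-order language $\mathscr{L}(K)$ is defined inductively: it contains all function, constant and predicate symbols of $\mathscr{L}$, and for every formula $\phi$ of $\mathscr{L}(K)$ it contains a new $0$-ary predicate symbol $K_\phi$. Write $K(\phi)$ for $K_\phi$ (so $K(K(\phi))$ is $K_{K_\phi}$, etc.). Thus $K(\phi)$ is an atomic sentence, even if $\phi$ has free variables, and substitution for variables does not act inside $K(\cdot)$. Logic is ordinary classical first-order logic (with equality); implications associate to the right. Semantics. For a structure $\mathscr{M}$ and a formula $\phi$, $\mathscr{M}\models\phi$ means $\phi$ holds in $\mathscr{M}$ under all variable assignments; for a set $\Gamma$ of formulas, $\Gamma\models\phi$ means every model of $\Gamma$ satisfies $\phi$. The axioms of a knowing machine are the following schemas ($\phi,\psi$ ranging over $\mathscr{L}(K)$-formulas): (1) Knowledge of Tautology: $K(\phi)$ whenever $\phi$ is tautological (i.e. logically valid). (2) Knowledge Modus Ponens: $K(\phi\rightarrow\psi)\rightarrow K(\phi)\rightarrow K(\psi)$. (3) Knowledge of Arithmetic: $K(\phi)$ whenever $\phi$ is an axiom of $PA$. (4) Closure: $K(\phi)$ whenever $\phi$ is an instance of (1), (2) or (3). (5) Factivity: $K(\phi)\rightarrow\phi$.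 Coding. Fix a standard Gödel numbering $\phi\mapsto\ulcorner\phi\urcorner\in\mathbb{N}$ of $\mathscr{L}(K)$-formulas, and let $W_e$ be the $e$-th r.e. subset of $\mathbb{N}$ in a standard enumeration. Inside formulas, ''$\ulcorner\phi\urcorner\in W_e$'' abbreviates a canonical sentence of the language of $PA$ expressing that $\ulcorner\phi\urcorner$ belongs to the $e$-th r.e. set. The schema $K(K(\phi)\leftrightarrow\ulcorner\phi\urcorner\in W_e)$ is called Knowledge of having Gödel number $e$. A knowing entity is an $\mathscr{L}(K)$-structure $\mathscr{M}$ with universe $\mathbb{N}$, interpreting the symbols of $PA$ as usual, such that $\mathscr{M}$ satisfies the axioms of a knowing machine. A knowing machine is a knowing entity $\mathscr{M}$ such that $\{\ulcorner\phi\urcorner : \mathscr{M}\models K(\phi)\}$ is recursively enumerable. *)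

(* Defs.v *)
From Stdlib Require Import Arith Cantor.

(** The language L(K).  Variables are de Bruijn indices.  [Know phi] is the
    0-ary predicate symbol K_phi: an atomic sentence, whatever variables are
    free in [phi]. *)

Inductive term : Type :=
| Var (n : nat)
| Zero
| Succ (t : term)
| Plus (s t : term)
| Mult (s t : term).

Inductive formula : Type :=
| Bot
| Equal (s t : term)
| Imp (phi psi : formula)
| All (phi : formula)
| Know (phi : formula).

Definition Neg (phi : formula) : formula := Imp phi Bot.
Definition Or (phi psi : formula) : formula := Imp (Neg phi) psi.
Definition And (phi psi : formula) : formula := Neg (Imp phi (Neg psi)).
Definition Iff (phi psi : formula) : formula := And (Imp phi psi) (Imp psi phi).
Definition Ex (phi : formula) : formula := Neg (All (Neg phi)).

(** The formulas of the language L of PA. *)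
Fixpoint K_free (phi : formula) : Prop :=
  match phi with
  | Bot | Equal _ _ => True
  | Imp phi psi => K_free phi /\ K_free psi
  | All phi => K_free phi
  | Know _ => False
  end.

Fixpoint subst_term (sigma : nat -> term) (t : term) : term :=
  match t with
  | Var n => sigma n
  | Zero => Zero
  | Succ t => Succ (subst_term sigma t)
  | Plus s t => Plus (subst_term sigma s) (subst_term sigma t)
  | Mult s t => Mult (subst_term sigma s) (subst_term sigma t)
  end.

Definition up (sigma : nat -> term) (n : nat) : term :=
  match n with
  | 0 => Var 0
  | S n => subst_term (fun k => Var (S k)) (sigma n)
  end.

Fixpoint subst (sigma : nat -> term) (phi : formula) : formula :=
  match phi with
  | Bot => Bot
  | Equal s t => Equal (subst_term sigma s) (subst_term sigma t)
  | Imp phi psi => Imp (subst sigma phi) (subst sigma psi)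
  | All phi => All (subst (up sigma) phi)
  | Know phi => Know phi
  end.

Fixpoint alls (k : nat) (phi : formula) : formula :=
  match k with
  | 0 => phi
  | S k => All (alls k phi)
  end.

Record structure : Type := {
  carrier :> Type;
  i_zero : carrier;
  i_succ : carrier -> carrier;
  i_plus : carrier -> carrier -> carrier;
  i_mult : carrier -> carrier -> carrier;
  i_know : formula -> Prop
}.

Fixpoint eval_term (M : structure) (rho : nat -> M) (t : term) : M :=
  match t with
  | Var n => rho n
  | Zero => i_zero M
  | Succ t => i_succ M (eval_term M rho t)
  | Plus s t => i_plus M (eval_term M rho s) (eval_term M rho t)
  | Mult s t => i_mult M (eval_term M rho s) (eval_term M rho t)
  end.

Definition scons {X : Type} (x : X) (rho : nat -> X) (n : nat) : X :=
  match n with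
  | 0 => x
  | S n => rho n
  end.

Fixpoint sat (M : structure) (rho : nat -> M) (phi : formula) : Prop :=
  match phi with
  | Bot => False
  | Equal s t => eval_term M rho s = eval_term M rho t
  | Imp phi psi => sat M rho phi -> sat M rho psi
  | All phi => forall x : M, sat M (scons x rho) phi
  | Know phi => i_know M phi
  end.

Definition models (M : structure) (phi : formula) : Prop :=
  forall rho : nat -> M, sat M rho phi.

Definition models_set (M : structure) (Gamma : formula -> Prop) : Prop :=
  forall phi, Gamma phi -> models M phi.

Definition valid (phi : formula) : Prop :=
  forall M : structure, models M phi.

(** The structure with universe [nat], the usual interpretation of the symbols
    of PA, and K_phi interpreted by [KI phi]. *)
Definition arith_structure (KI : formula -> Prop) : structure :=
  {| carrier := nat;
     i_zero := 0;
     i_succ := S;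
     i_plus := Nat.add;
     i_mult := Nat.mul;
     i_know := KI |}.

(** phi(0) -> forall x (phi(x) -> phi(S x)) -> forall x phi(x), the induction
    variable being the index 0 of [phi]. *)
Definition induction (phi : formula) : formula :=
  Imp (subst (scons Zero Var) phi)
    (Imp (All (Imp phi (subst (scons (Succ (Var 0)) (fun n => Var (S n))) phi)))
       (All phi)).

(** An induction instance may be prefixed by any number of universal
    quantifiers; this includes its universal closure. *)
Inductive PA : formula -> Prop :=
| PA_succ_zero : PA (All (Neg (Equal (Succ (Var 0)) Zero)))
| PA_succ_inj :
    PA (All (All (Imp (Equal (Succ (Var 1)) (Succ (Var 0))) (Equal (Var 1) (Var 0)))))
| PA_plus_zero : PA (All (Equal (Plus (Var 0) Zero) (Var 0)))
| PA_plus_succ :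
    PA (All (All (Equal (Plus (Var 1) (Succ (Var 0)))
                     (Succ (Plus (Var 1) (Var 0))))))
| PA_mult_zero : PA (All (Equal (Mult (Var 0) Zero) Zero))
| PA_mult_succ :
    PA (All (All (Equal (Mult (Var 1) (Succ (Var 0)))
                     (Plus (Mult (Var 1) (Var 0)) (Var 1)))))
| PA_induction (k : nat) (phi : formula) :
    K_free phi -> PA (alls k (induction phi)).

Inductive basic_axiom : formula -> Prop :=
| knowledge_of_tautology (phi : formula) :
    valid phi -> basic_axiom (Know phi)
| knowledge_modus_ponens (phi psi : formula) :
    basic_axiom (Imp (Know (Imp phi psi)) (Imp (Know phi) (Know psi)))
| knowledge_of_arithmetic (phi : formula) :
    PA phi -> basic_axiom (Know phi).

Inductive knowing_axiom : formula -> Prop :=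
| knowing_basic (phi : formula) :
    basic_axiom phi -> knowing_axiom phi
| closure (phi : formula) :
    basic_axiom phi -> knowing_axiom (Know phi)
| factivity (phi : formula) :
    knowing_axiom (Imp (Know phi) phi).

(** Partial recursive functions are presented as unary functions on [nat],
    several arguments being packed by Cantor pairing. *)

Notation npair x y := (to_nat (x, y)).

Inductive code : Type :=
| CZero
| CSucc
| CLeft
| CRight
| CPair (f g : code)
| CComp (f g : code)
| CPrec (f g : code)
| CFind (f : code).

(** [eval c x y]: the function coded by [c] is defined at [x] with value [y].
    [CFind f] at <a, m> searches for the least n >= m with f<a, n> = 0, the
    values f<a, j> for m <= j < n being defined and nonzero. *)
Inductive eval : code -> nat -> nat -> Prop :=
| eval_zero x : eval CZero x 0
| eval_succ x : eval CSucc x (S x)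
| eval_left a b : eval CLeft (npair a b) a
| eval_right a b : eval CRight (npair a b) b
| eval_pair f g x u v :
    eval f x u -> eval g x v -> eval (CPair f g) x (npair u v)
| eval_comp f g x u y :
    eval g x u -> eval f u y -> eval (CComp f g) x y
| eval_prec_0 f g a y :
    eval f a y -> eval (CPrec f g) (npair a 0) y
| eval_prec_S f g a n u y :
    eval (CPrec f g) (npair a n) u -> eval g (npair a (npair n u)) y ->
    eval (CPrec f g) (npair a (S n)) y
| eval_find_stop f a m :
    eval f (npair a m) 0 -> eval (CFind f) (npair a m) m
| eval_find_next f a m k y :
    eval f (npair a m) (S k) -> eval (CFind f) (npair a (S m)) y ->
    eval (CFind f) (npair a m) y.

(** Cantor pairing being bijective, so is this numbering of [code]. *)
Fixpoint code_num (c : code) : nat :=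
  match c with
  | CZero => 0
  | CSucc => 1
  | CLeft => 2
  | CRight => 3
  | CPair f g => 4 + 4 * npair (code_num f) (code_num g)
  | CComp f g => 5 + 4 * npair (code_num f) (code_num g)
  | CPrec f g => 6 + 4 * npair (code_num f) (code_num g)
  | CFind f => 7 + 4 * code_num f
  end.

(** The [e]-th r.e. set: the domain of the [e]-th partial recursive function. *)
Definition W (e n : nat) : Prop :=
  exists c : code, code_num c = e /\ exists y, eval c n y.

Definition recursively_enumerable (A : nat -> Prop) : Prop :=
  exists e, forall n, A n <-> W e n.

Fixpoint godel_term (t : term) : nat :=
  match t with
  | Var n => npair 0 n
  | Zero => npair 1 0
  | Succ t => npair 2 (godel_term t)
  | Plus s t => npair 3 (npair (godel_term s) (godel_term t))
  | Mult s t => npair 4 (npair (godel_term s) (godel_term t))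
  end.

Fixpoint godel (phi : formula) : nat :=
  match phi with
  | Bot => npair 0 0
  | Equal s t => npair 1 (npair (godel_term s) (godel_term t))
  | Imp phi psi => npair 2 (npair (godel phi) (godel psi))
  | All phi => npair 3 (godel phi)
  | Know phi => npair 4 (godel phi)
  end.

Fixpoint numeral (n : nat) : term :=
  match n with
  | 0 => Zero
  | S n => Succ (numeral n)
  end.

(** To write the sentence "n is in W_e" of the language of PA with named bound
    variables, formulas are built as functions of the number [d] of enclosing
    quantifiers: the variable bound by a quantifier at depth [d] has, at depth
    [d'], the de Bruijn index [d' - S d]. *)

Definition dterm : Type := nat -> term.
Definition dformula : Type := nat -> formula.

Definition dnumeral (n : nat) : dterm := fun _ => numeral n.
Definition dsucc (s : dterm) : dterm := fun d => Succ (s d).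
Definition dplus (s t : dterm) : dterm := fun d => Plus (s d) (t d).
Definition dmult (s t : dterm) : dterm := fun d => Mult (s d) (t d).
Definition deq (s t : dterm) : dformula := fun d => Equal (s d) (t d).
Definition dand (A B : dformula) : dformula := fun d => And (A d) (B d).
Definition dor (A B : dformula) : dformula := fun d => Or (A d) (B d).
Definition dimp (A B : dformula) : dformula := fun d => Imp (A d) (B d).
Definition dall (F : dterm -> dformula) : dformula :=
  fun d => All (F (fun d' => Var (d' - S d)) (S d)).
Definition dex (F : dterm -> dformula) : dformula :=
  fun d => Ex (F (fun d' => Var (d' - S d)) (S d)).

Declare Scope dterm_scope.
Declare Scope dformula_scope.
Delimit Scope dterm_scope with dt.
Delimit Scope dformula_scope with df.
Bind Scope dterm_scope with dterm.
Bind Scope dformula_scope with dformula.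

Local Infix "+" := dplus : dterm_scope.
Local Infix "*" := dmult : dterm_scope.
Local Infix "==" := deq (at level 70) : dformula_scope.
Local Infix "/\" := dand : dformula_scope.
Local Infix "\/" := dor : dformula_scope.
Local Infix "-->" := dimp (at level 90, right associativity) : dformula_scope.
Local Notation "'EX' x .. y , A" := (dex (fun x => .. (dex (fun y => A%df)) ..))
  (at level 200, x binder, y binder, right associativity) : dformula_scope.
Local Notation "'ALL' x .. y , A" := (dall (fun x => .. (dall (fun y => A%df)) ..))
  (at level 200, x binder, y binder, right associativity) : dformula_scope.

Definition dlt (s t : dterm) : dformula := (EX z, dsucc (s + z) == t)%df.

(** p = <x, y>, in the form 2 p = (x + y) (x + y + 1) + 2 y. *)
Definition dpair (x y p : dterm) : dformula :=
  (p + p == (x + y) * dsucc (x + y) + (y + y))%df.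

(** Gödel's beta function: v = a mod (1 + (i + 1) b). *)
Definition dbeta (a b i v : dterm) : dformula :=
  (dlt v (dsucc (dsucc i * b))
   /\ EX q, a == q * dsucc (dsucc i * b) + v)%df.

(** The [i]-th item of the sequence coded by (a, b) is the triple (c, x, y),
    read as: the function with number [c] takes the value [y] at [x]. *)
Definition ditem (a b i c x y : dterm) : dformula :=
  (EX q p, dpair x y q /\ dpair c q p /\ dbeta a b i p)%df.

Definition dearlier (a b i c x y : dterm) : dformula :=
  (EX j, dlt j i /\ ditem a b j c x y)%df.

Definition dtag (k : nat) (p c : dterm) : dformula :=
  (c == dnumeral k + dnumeral 4 * p)%df.

(** The triple (c, x, y) follows by one of the rules defining [eval] from
    triples satisfying [P]. *)
Definition dstep (P : dterm -> dterm -> dterm -> dformula) (c x y : dterm)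
  : dformula :=
  ( (c == dnumeral 0 /\ y == dnumeral 0)
 \/ (c == dnumeral 1 /\ y == dsucc x)
 \/ (c == dnumeral 2 /\ EX b, dpair y b x)
 \/ (c == dnumeral 3 /\ EX a, dpair a y x)
 \/ (EX f g p, dpair f g p /\ dtag 4 p c
       /\ EX u v, P f x u /\ P g x v /\ dpair u v y)
 \/ (EX f g p, dpair f g p /\ dtag 5 p c
       /\ EX u, P g x u /\ P f u y)
 \/ (EX f g p, dpair f g p /\ dtag 6 p c
       /\ EX a, dpair a (dnumeral 0) x /\ P f a y)
 \/ (EX f g p, dpair f g p /\ dtag 6 p c
       /\ EX a n u w nu z, dpair a (dsucc n) x
            /\ dpair a n w /\ P c w u
            /\ dpair n u nu /\ dpair a nu z /\ P g z y)
 \/ (EX f, dtag 7 f c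
       /\ EX a, dpair a y x /\ P f x (dnumeral 0))
 \/ (EX f, dtag 7 f c
       /\ EX a m k w, dpair a m x /\ P f x (dsucc k)
            /\ dpair a (dsucc m) w /\ P c w y))%df.

(** Some finite sequence of triples, each of which follows from earlier ones,
    contains (e, n, y) for some y. *)
Definition mem_W (e n : nat) : formula :=
  (EX a b l y, ditem a b l (dnumeral e) (dnumeral n) y
    /\ ALL i, dlt i (dsucc l)
         --> EX c x z, ditem a b i c x z /\ dstep (dearlier a b i) c x z)%df 0.

Definition knowing_entity (M : structure) : Prop :=
  (exists KI : formula -> Prop, M = arith_structure KI) /\
  models_set M knowing_axiom.

Definition knowing_machine (M : structure) : Prop :=
  knowing_entity M /\
  recursively_enumerable
    (fun n => exists phi, n = godel phi /\ models M (Know phi)).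

Inductive Sigma (e : nat) : formula -> Prop :=
| Sigma_knowing (phi : formula) :
    knowing_axiom phi -> Sigma e phi
| Sigma_godel_number (phi : formula) :
    Sigma e (Know (Iff (Know phi) (mem_W e (godel phi)))).

(* Main.v *)
Require Import Defs.
From Stdlib Require Import Arith Lia List Cantor Factorial.
From Stdlib Require Import Classical ClassicalEpsilon.
From Stdlib Require Import FunctionalExtensionality PropExtensionality.
Import ListNotations.

(** The machine knows the theorems of a formal theory that contains a
    description of its own set of theorems.

    For each number [e] let [knows e] be the set of theorems of a Hilbert
    calculus that has, besides logic, the axioms of arithmetic, the modus
    ponens schema for K, the rule from phi to K(phi), and the axioms
    K(phi) <-> phi in W_e.  Derivations can be enumerated uniformly in [e], so
    the recursion theorem gives an [e] for which W_e is the set of Gödel numbers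
    of [knows e] ([index_exists]).  Fix this [e] and interpret K by [knows e] in
    the natural numbers.  Every theorem is then true, by induction on
    derivations ([knows_true]): the rule from phi to K(phi) holds by the
    definition of the interpretation, and the axioms K(phi) <-> phi in W_e hold
    because W_e is what it should be.  Factivity is this soundness statement.
    The other axioms say that certain formulas are theorems, which holds by the
    choice of the calculus, given that valid formulas are theorems.

    Three facts carry the argument.
    - [completeness]: valid formulas are provable.  The proof is Henkin's, with
      the free variables serving as witnesses and the terms modulo provable
      equality as the countermodel.
    - [semidecidable_derives]: the consequences of a finite set of Horn clauses
      over pairs of numbers are recursively enumerable.  The calculus, with its
      substitutions, is such a set of clauses ([rule]), so no other program has
      to be written.
    - [mem_W_correct]: the sentence [mem_W e n] is true in the natural numbers
      exactly when [n] is in W_e.  A halting computation is a finite sequence of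
      evaluations each justified by earlier ones, and the beta function codes
      every finite sequence. *)

(** * Computable functions *)

(* Pairs of literals would otherwise be computed in unary. *)
Global Opaque to_nat of_nat.

Definition pfst (z : nat) : nat := fst (of_nat z).
Definition psnd (z : nat) : nat := snd (of_nat z).

Lemma npair_inj a b c d : npair a b = npair c d -> a = c /\ b = d.
Proof. intros H%to_nat_inj. now injection H. Qed.

Lemma pfst_npair a b : pfst (npair a b) = a.
Proof. unfold pfst. now rewrite cancel_of_to. Qed.

Lemma psnd_npair a b : psnd (npair a b) = b.
Proof. unfold psnd. now rewrite cancel_of_to. Qed.

Lemma npair_proj z : npair (pfst z) (psnd z) = z.
Proof.
  unfold pfst, psnd. rewrite <- surjective_pairing. apply cancel_to_of.
Qed.

Lemma proj_le z : pfst z <= z /\ psnd z <= z.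
Proof.
  rewrite <- (npair_proj z) at 2 4.
  pose proof (to_nat_non_decreasing (pfst z) (psnd z)). lia.
Qed.

Lemma eval_deterministic c x y y' : eval c x y -> eval c x y' -> y = y'.
Proof.
  intros H. revert y'.
  (* The argument is abstracted so that inversion does not unfold pairing. *)
  induction H; intros z Hz;
    match type of Hz with eval _ ?x _ => remember x as arg eqn:Earg in Hz end;
    inversion Hz; clear Hz; subst;
    repeat match goal with
    | H : npair _ _ = npair _ _ |- _ =>
        apply npair_inj in H; destruct H; try discriminate; subst
    | H : S ?n = S ?m |- _ => is_var n; is_var m; injection H as H; subst
    end; auto.
  all: repeat match goal with
    | IH : forall z, eval ?c ?x z -> ?u = z, H : eval ?c ?x _ |- _ =>
        apply IH in H; try discriminate H; subst
    end; auto.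
Qed.

Definition computable (f : nat -> nat) : Prop :=
  exists c, forall x, eval c x (f x).

Lemma computable_ext f g :
  (forall x, f x = g x) -> computable f -> computable g.
Proof. intros H [c Hc]. exists c. intros x. rewrite <- H. apply Hc. Qed.

Lemma computable_pfst : computable pfst.
Proof.
  exists CLeft. intros x. rewrite <- (npair_proj x) at 1. constructor.
Qed.

Lemma computable_psnd : computable psnd.
Proof.
  exists CRight. intros x. rewrite <- (npair_proj x) at 1. constructor.
Qed.

Definition id_code : code := CPair CLeft CRight.

Lemma eval_id_code x : eval id_code x x.
Proof. rewrite <- (npair_proj x). repeat constructor. Qed.

Lemma computable_id : computable (fun x => x).
Proof. exists id_code. apply eval_id_code. Qed.

Fixpoint const_code (n : nat) : code :=
  match n with
  | 0 => CZero
  | S n => CComp CSucc (const_code n)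
  end.

Lemma eval_const_code n x : eval (const_code n) x n.
Proof. induction n; simpl; econstructor; eauto. constructor. Qed.

Lemma computable_const n : computable (fun _ => n).
Proof. exists (const_code n). apply eval_const_code. Qed.

Lemma computable_comp f g :
  computable f -> computable g -> computable (fun x => f (g x)).
Proof.
  intros [c Hc] [d Hd]. exists (CComp c d). intros x. econstructor; eauto.
Qed.

Lemma computable_pair f g :
  computable f -> computable g -> computable (fun x => npair (f x) (g x)).
Proof.
  intros [c Hc] [d Hd]. exists (CPair c d). intros x. constructor; auto.
Qed.

Lemma computable_succ f : computable f -> computable (fun x => S (f x)).
Proof.
  intros Hf. apply (computable_comp S); auto. exists CSucc. constructor.
Qed.

Lemma computable_pfst_of f : computable f -> computable (fun x => pfst (f x)).
Proof. apply computable_comp, computable_pfst. Qed.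

Lemma computable_psnd_of f : computable f -> computable (fun x => psnd (f x)).
Proof. apply computable_comp, computable_psnd. Qed.

Create HintDb computable.
#[local] Hint Resolve computable_id computable_const computable_pair computable_succ
  computable_pfst_of computable_psnd_of : computable.

(** The form in which primitive recursion is used: the packing of the parameter
    into pairs is confined to the premise about the step. *)
Lemma computable_rec (f : nat -> nat) (g : nat -> nat -> nat -> nat)
    (h : nat -> nat) :
  computable f ->
  computable (fun z => g (pfst z) (pfst (psnd z)) (psnd (psnd z))) ->
  computable h ->
  computable (fun x => nat_rec (fun _ => nat) (f x) (g x) (h x)).
Proof.
  intros [c Hc] [d Hd] Hh.
  apply (computable_ext
    (fun x => (fun z => nat_rec (fun _ => nat) (f (pfst z)) (g (pfst z)) (psnd z))
                (npair x (h x)))).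
  { intros x. cbv beta. now rewrite pfst_npair, psnd_npair. }
  apply (computable_comp (fun z =>
    nat_rec (fun _ => nat) (f (pfst z)) (g (pfst z)) (psnd z)));
    auto with computable.
  exists (CPrec c d). intros z. rewrite <- (npair_proj z) at 1.
  induction (psnd z) as [|n IH]; simpl.
  - constructor. apply Hc.
  - econstructor; [exact IH|].
    specialize (Hd (npair (pfst z)
      (npair n (nat_rec (fun _ => nat) (f (pfst z)) (g (pfst z)) n)))).
    now rewrite !psnd_npair, !pfst_npair in Hd.
Qed.

Lemma computable_add f g :
  computable f -> computable g -> computable (fun x => f x + g x).
Proof.
  intros Hf Hg.
  apply (computable_ext
    (fun x => nat_rec (fun _ => nat) (f x) (fun _ u => S u) (g x))).
  { intros x. induction (g x); simpl; lia. }
  apply (computable_rec f (fun _ _ u => S u)); auto with computable.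
Qed.

Lemma computable_pred f : computable f -> computable (fun x => pred (f x)).
Proof.
  intros Hf.
  apply (computable_ext
    (fun x => nat_rec (fun _ => nat) 0 (fun n _ => n) (f x))).
  { intros x. now destruct (f x). }
  apply (computable_rec (fun _ => 0) (fun _ n _ => n)); auto with computable.
Qed.
#[local] Hint Resolve computable_add computable_pred : computable.

Lemma computable_sub f g :
  computable f -> computable g -> computable (fun x => f x - g x).
Proof.
  intros Hf Hg.
  apply (computable_ext
    (fun x => nat_rec (fun _ => nat) (f x) (fun _ u => pred u) (g x))).
  { intros x. induction (g x); simpl; lia. }
  apply (computable_rec f (fun _ _ u => pred u)); auto with computable.
Qed.
#[local] Hint Resolve computable_sub : computable.

Definition if_zero (n a b : nat) : nat := match n with 0 => a | S _ => b end.

Lemma computable_if_zero f g h :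
  computable f -> computable g -> computable h ->
  computable (fun x => if_zero (f x) (g x) (h x)).
Proof.
  intros Hf Hg Hh.
  apply (computable_ext
    (fun x => nat_rec (fun _ => nat) (g x) (fun _ _ => h x) (f x))).
  { intros x. now destruct (f x). }
  apply (computable_rec g (fun x _ _ => h x)); auto.
  apply (computable_comp h); auto with computable.
Qed.
#[local] Hint Resolve computable_if_zero : computable.

Definition dist (a b : nat) : nat := (a - b) + (b - a).

Lemma dist_zero a b : dist a b = 0 <-> a = b.
Proof. unfold dist. lia. Qed.

Lemma computable_dist f g :
  computable f -> computable g -> computable (fun x => dist (f x) (g x)).
Proof. unfold dist. auto with computable. Qed.
#[local] Hint Resolve computable_dist : computable.

(** Every number codes an infinite sequence that is eventually 0, since the
    projections of 0 are 0; so there is no end of a list to test for. *)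
Definition item (k l : nat) : nat :=
  pfst (nat_rec (fun _ => nat) l (fun _ u => psnd u) k).

Lemma item_0 a l : item 0 (npair a l) = a.
Proof. apply pfst_npair. Qed.

Lemma item_S k a l : item (S k) (npair a l) = item k l.
Proof.
  unfold item. f_equal.
  induction k as [|k IH]; simpl in *; [apply psnd_npair | now rewrite IH].
Qed.

Lemma item_le k l : item k l <= l.
Proof.
  unfold item. etransitivity; [apply proj_le|].
  induction k; simpl; [lia|]. etransitivity; [apply proj_le|assumption].
Qed.

Lemma computable_item f g :
  computable f -> computable g -> computable (fun x => item (f x) (g x)).
Proof.
  intros Hf Hg. unfold item. apply computable_pfst_of.
  apply (computable_rec g (fun _ _ u => psnd u)); auto with computable.
Qed.
#[local] Hint Resolve computable_item : computable.

Lemma item_surjective (s : nat -> nat) (n : nat) :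
  exists l, forall k, k < n -> item k l = s k.
Proof.
  revert s. induction n as [|n IH]; intros s.
  - exists 0. lia.
  - destruct (IH (fun k => s (S k))) as [l Hl]. exists (npair (s 0) l).
    intros [|k] Hk; [apply item_0 | rewrite item_S; apply Hl; lia].
Qed.

(** * Semidecidable sets and the recursion theorem *)

Definition semidecidable (A : nat -> Prop) : Prop :=
  exists c, forall x, A x <-> exists y, eval c x y.

Lemma semidecidable_preimage A f :
  semidecidable A -> computable f -> semidecidable (fun x => A (f x)).
Proof.
  intros [c Hc] [d Hd]. exists (CComp c d). intros x. rewrite Hc. split.
  - intros [y Hy]. exists y. econstructor; eauto.
  - intros [y Hy]. exists y. inversion Hy; subst.
    now rewrite (eval_deterministic _ _ _ _ (Hd x) ltac:(eassumption)).
Qed.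

(** Unbounded search is the only source of partiality. *)
Lemma semidecidable_exists F :
  computable F -> semidecidable (fun x => exists w, F (npair x w) = 0).
Proof.
  intros [c Hc].
  cut (exists d, forall z, (exists y, eval d z y)
                   <-> exists w, psnd z <= w /\ F (npair (pfst z) w) = 0).
  { intros [d Hd].
    destruct (semidecidable_preimage (fun z => exists y, eval d z y)
                (fun x => npair x 0)) as [e He].
    - now exists d.
    - auto with computable.
    - exists e. intros x. rewrite <- He, Hd, psnd_npair, pfst_npair.
      split; [|firstorder].
      intros [w Hw]. exists w. split; [lia | assumption]. }
  exists (CFind c). intros z. split.
  - intros [y Hy]. remember (CFind c) as d eqn:Ed.
    induction Hy; try discriminate; injection Ed as ->.
    + rewrite psnd_npair, pfst_npair. exists m. split; [lia|].
      apply (eval_deterministic _ _ _ _ (Hc _) Hy).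
    + rewrite psnd_npair, pfst_npair in *.
      destruct (IHHy2 eq_refl) as (w & Hw & H0). exists w. split; [lia | easy].
  - intros (w & Hw & H0). rewrite <- (npair_proj z).
    remember (w - psnd z) as k eqn:Ek.
    revert Ek Hw. generalize (psnd z). induction k as [|k IH]; intros m Ek Hw.
    + assert (m = w) as -> by lia. exists w. constructor.
      rewrite <- H0. apply Hc.
    + destruct (F (npair (pfst z) m)) as [|r] eqn:Er.
      * exists m. constructor. rewrite <- Er. apply Hc.
      * destruct (IH (S m)) as [y Hy]; [lia | lia |]. exists y.
        apply eval_find_next with r; [rewrite <- Er; apply Hc | assumption].
Qed.

Lemma code_num_inj c d : code_num c = code_num d -> c = d.
Proof.
  revert d. induction c; intros []; cbn -[Nat.mul]; intros H; try lia;
    try (assert (Hp : npair (code_num c1) (code_num c2)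
               = npair (code_num f) (code_num g)) by lia;
         apply npair_inj in Hp; destruct Hp; f_equal; auto).
  - reflexivity.
  - reflexivity.
  - reflexivity.
  - reflexivity.
  - f_equal. apply IHc. lia.
Qed.

Lemma W_code_num c n : W (code_num c) n <-> exists y, eval c n y.
Proof.
  split.
  - intros (d & Hd & Hy). now apply code_num_inj in Hd as ->.
  - intros H. now exists c.
Qed.

(** The s-m-n construction. *)
Definition specialize (c : code) (k : nat) : code :=
  CComp c (CPair (const_code k) id_code).

Lemma eval_specialize c k n y :
  eval (specialize c k) n y <-> eval c (npair k n) y.
Proof.
  assert (H : eval (CPair (const_code k) id_code) n (npair k n))
    by (constructor; [apply eval_const_code | apply eval_id_code]).
  split.
  - intros Hy. inversion Hy; subst.
    now rewrite (eval_deterministic _ _ _ _ H ltac:(eassumption)).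
  - intros Hy. econstructor; eauto.
Qed.

(** The number of [specialize c k] is obtained from those of [c] and [k] by
    pairing and addition, 4 n being n + n + n + n. *)
Lemma computable_code_num_specialize :
  exists s, computable s /\
    forall c, s (code_num c) = code_num (specialize c (code_num c)).
Proof.
  assert (Hk : computable (fun k => code_num (const_code k))).
  { apply (computable_ext (fun k => nat_rec (fun _ => nat) 0
      (fun _ u => let p := npair 1 u in 5 + (p + p + (p + p))) k)).
    { intros k. induction k as [|k IH]; [reflexivity|].
      cbn -[Nat.add Nat.mul] in *. rewrite IH. lia. }
    apply (computable_rec (fun _ => 0)
      (fun _ _ u => let p := npair 1 u in 5 + (p + p + (p + p))));
      auto 20 with computable. }
  set (i := code_num id_code).
  exists (fun x => let q := npair (code_num (const_code x)) i in
                   let p := npair x (4 + (q + q + (q + q))) in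
                   5 + (p + p + (p + p))).
  split.
  - cbv zeta. auto 20 with computable.
  - intros c. cbn -[Nat.add Nat.mul id_code]. fold i.
    set (q := npair _ i). replace (q + q + (q + q)) with (4 * q) by lia.
    set (p := npair _ _). lia.
Qed.

(** Kleene's diagonal argument.  Let [c] accept <x, n> when [A] holds of
    <s x, n>, where s x is the number of the code numbered x specialized at x.
    Then [c] specialized at its own number has the number s (code_num c). *)
Theorem recursion_theorem (A : nat -> Prop) :
  semidecidable A -> exists e, forall n, W e n <-> A (npair e n).
Proof.
  intros HA. destruct computable_code_num_specialize as (s & Hs & Es).
  destruct (semidecidable_preimage A
    (fun z => npair (s (pfst z)) (psnd z)) HA) as [c Hc];
    [pose proof (computable_comp s pfst Hs); auto with computable|].
  exists (code_num (specialize c (code_num c))). intros n.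
  rewrite W_code_num. specialize (Hc (npair (code_num c) n)).
  rewrite pfst_npair, psnd_npair, Es in Hc. rewrite Hc.
  split; intros [y Hy]; exists y; now apply eval_specialize.
Qed.

(** * Logic programs *)

Inductive pattern : Type :=
| PVar (i : nat)
| PZero
| PSucc (p : pattern)
| PPair (p q : pattern).

Fixpoint peval (rho : nat -> nat) (p : pattern) : nat :=
  match p with
  | PVar i => rho i
  | PZero => 0
  | PSucc p => S (peval rho p)
  | PPair p q => npair (peval rho p) (peval rho q)
  end.

Record clause : Type := Clause {
  premises : list pattern;
  conclusion : pattern
}.

Inductive derives (P : list clause) : nat -> Prop :=
| derives_clause C rho :
    In C P ->
    (forall p, In p (premises C) -> derives P (peval rho p)) ->
    derives P (peval rho (conclusion C)).

Fixpoint pvars (p : pattern) : nat :=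
  match p with
  | PVar i => S i
  | PZero => 0
  | PSucc p => pvars p
  | PPair p q => max (pvars p) (pvars q)
  end.

Lemma peval_ext rho rho' p :
  (forall i, i < pvars p -> rho i = rho' i) -> peval rho p = peval rho' p.
Proof.
  induction p; simpl; intros H; auto.
  rewrite IHp1, IHp2; auto; intros i Hi; apply H; lia.
Qed.

(** Derivations are coded by numbers.  S <i, <a, ws>> is the derivation that
    ends with clause [i], the variables being instantiated by the entries of [a]
    and the premises being derived by the entries of [ws], which are smaller
    numbers.  The conclusion of an ill-formed code is 0, that of any other code
    is the successor of the number derived.  As the recursion is over all
    smaller codes, [hist m] computes the list of the conclusions of m, ..., 0. *)

Fixpoint mismatch (a : nat) (concl : nat -> nat) (ps : list pattern) (k : nat)
  : nat :=
  match ps with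
  | [] => 0
  | p :: ps =>
      dist (concl k) (S (peval (fun i => item i a) p))
      + mismatch a concl ps (S k)
  end.

Fixpoint last_step (P : list clause) (i a : nat) (concl : nat -> nat) : nat :=
  match P with
  | [] => 0
  | C :: P =>
      if_zero i
        (if_zero (mismatch a concl (premises C) 0)
           (S (peval (fun i => item i a) (conclusion C))) 0)
        (last_step P (pred i) a concl)
  end.

Definition conclude (P : list clause) (m hist : nat) : nat :=
  last_step P (pfst m) (pfst (psnd m))
    (fun k => item (m - item k (psnd (psnd m))) hist).

Definition hist (P : list clause) (m : nat) : nat :=
  nat_rec (fun _ => nat) (npair 0 0)
    (fun m h => npair (conclude P m h) h) m.

Definition concl (P : list clause) (w : nat) : nat := pfst (hist P w).

Lemma computable_peval f p :
  computable f -> computable (fun x => peval (fun i => item i (f x)) p).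
Proof. intros Hf. induction p; simpl; auto with computable. Qed.

Lemma computable_mismatch f g ps k :
  computable f -> (forall k, computable (fun x => g x k)) ->
  computable (fun x => mismatch (f x) (g x) ps k).
Proof.
  intros Hf Hg. revert k.
  induction ps; simpl; auto using computable_peval with computable.
Qed.

Lemma computable_last_step P h f g :
  computable h -> computable f -> (forall k, computable (fun x => g x k)) ->
  computable (fun x => last_step P (h x) (f x) (g x)).
Proof.
  intros Hh Hf Hg. revert h Hh. induction P as [|C P IH]; simpl; intros h Hh.
  - auto with computable.
  - specialize (IH (fun x => pred (h x))).
    auto using computable_mismatch, computable_peval with computable.
Qed.

Lemma computable_concl P : computable (concl P).
Proof.
  apply computable_pfst_of.
  apply (computable_rec (fun _ => npair 0 0)
    (fun _ m h => npair (conclude P m h) h)); auto with computable.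
  apply computable_pair; auto with computable.
  apply computable_last_step; auto 10 with computable.
Qed.

Lemma item_hist P m k : k <= m -> item k (hist P m) = concl P (m - k).
Proof.
  revert k. induction m as [|m IH]; intros [|k] Hk; try lia; try reflexivity.
  change (hist P (S m)) with (npair (conclude P m (hist P m)) (hist P m)).
  rewrite item_S. simpl. apply IH. lia.
Qed.

Lemma mismatch_zero a c ps k :
  mismatch a c ps k = 0 <->
  forall j p, nth_error ps j = Some p ->
    c (j + k) = S (peval (fun i => item i a) p).
Proof.
  revert k. induction ps as [|q ps IH]; simpl; intros k.
  - split; [|reflexivity]. intros _ [] p; discriminate.
  - specialize (IH (S k)).
    pose proof (dist_zero (c k) (S (peval (fun i => item i a) q))) as Hd.
    split.
    + intros H [|j] p Hp; simpl in Hp.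
      * injection Hp as <-. apply Hd. lia.
      * replace (S j + k) with (j + S k) by lia. apply IH; [lia | easy].
    + intros H. assert (mismatch a c ps (S k) = 0) as ->.
      { apply IH. intros j p Hp. specialize (H (S j) p Hp).
        now rewrite <- H, <- plus_n_Sm. }
      rewrite Nat.add_0_r. apply Hd. apply (H 0). reflexivity.
Qed.

Lemma last_step_spec P i a c v :
  last_step P i a c = S v <->
  exists C, nth_error P i = Some C /\
    mismatch a c (premises C) 0 = 0 /\
    v = peval (fun i => item i a) (conclusion C).
Proof.
  revert i. induction P as [|C P IH]; intros i; simpl.
  - split; [discriminate|]. intros (C & HC & _). now destruct i.
  - destruct i as [|i]; simpl.
    + split.
      * destruct (mismatch a c (premises C) 0) eqn:E; simpl; [|discriminate].
        intros [= <-]. eauto.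
      * intros (C' & [= <-] & -> & ->). reflexivity.
    + apply IH.
Qed.

Lemma concl_S P m v :
  concl P (S m) = S v <->
  exists C, nth_error P (pfst m) = Some C /\
    (forall j p, nth_error (premises C) j = Some p ->
       concl P (item j (psnd (psnd m)))
       = S (peval (fun i => item i (pfst (psnd m))) p)) /\
    v = peval (fun i => item i (pfst (psnd m))) (conclusion C).
Proof.
  assert (E : forall j, item (m - item (j + 0) (psnd (psnd m))) (hist P m)
                        = concl P (item j (psnd (psnd m)))).
  { intros j. rewrite Nat.add_0_r, item_hist by lia. f_equal.
    pose proof (item_le j (psnd (psnd m))). pose proof (proj_le m).
    pose proof (proj_le (psnd m)). lia. }
  unfold concl at 1.
  change (hist P (S m)) with (npair (conclude P m (hist P m)) (hist P m)).
  rewrite pfst_npair. unfold conclude. rewrite last_step_spec.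
  split; intros (C & HC & H & Hv); exists C; repeat split; auto.
  - intros j p Hp. rewrite <- E. now apply (proj1 (mismatch_zero _ _ _ _) H).
  - apply mismatch_zero. intros j p Hp. rewrite E. now apply H.
Qed.

Lemma derives_iff_concl P v : derives P v <-> exists w, concl P w = S v.
Proof.
  split.
  - intros H. induction H as [C rho HC _ IH].
    apply In_nth_error in HC. destruct HC as [i Hi].
    destruct (item_surjective rho
      (list_max (map pvars (conclusion C :: premises C)))) as [a Ha].
    assert (Hvars : forall p, In p (conclusion C :: premises C) ->
              peval (fun i => item i a) p = peval rho p).
    { intros p Hp. apply peval_ext. intros k Hk. apply Ha.
      eapply Nat.lt_le_trans; [exact Hk|].
      pose proof (proj1 (list_max_le (map pvars (conclusion C :: premises C)) _)
        (le_n _)) as Hmax.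
      rewrite Forall_forall in Hmax. now apply Hmax, in_map. }
    assert (Hws : exists ws, forall j p, nth_error (premises C) j = Some p ->
              concl P (item j ws) = S (peval rho p)).
    { clear Hi Hvars Ha.
      induction (premises C) as [|p ps IHps].
      - exists 0. intros [] p; discriminate.
      - destruct IHps as [ws Hws]; [intros; apply IH; now right|].
        destruct (IH p) as [w Hw]; [now left|].
        exists (npair w ws). intros [|j] q Hq.
        + rewrite item_0. now injection Hq as <-.
        + rewrite item_S. now apply Hws. }
    destruct Hws as [ws Hws].
    exists (S (npair i (npair a ws))). apply concl_S. exists C.
    rewrite !psnd_npair, !pfst_npair. repeat split; auto.
    + intros j p Hp. rewrite Hvars; [now apply Hws|].
      right. now apply nth_error_In in Hp.
    + symmetry. apply Hvars. now left.
  - intros [w Hw]. revert v Hw.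
    induction w as [[|m] IH] using lt_wf_ind; intros v Hw.
    + unfold concl in Hw. simpl in Hw. now rewrite pfst_npair in Hw.
    + apply concl_S in Hw. destruct Hw as (C & HC & Hps & ->).
      apply derives_clause; [now apply nth_error_In in HC|].
      intros p [j Hj]%In_nth_error. apply (IH _) with (2 := Hps _ _ Hj).
      pose proof (item_le j (psnd (psnd m))). pose proof (proj_le m).
      pose proof (proj_le (psnd m)). lia.
Qed.

Theorem semidecidable_derives P : semidecidable (derives P).
Proof.
  destruct (semidecidable_exists
    (fun z => dist (concl P (psnd z)) (S (pfst z)))) as [c Hc].
  { pose proof (computable_comp _ psnd (computable_concl P)).
    auto with computable. }
  exists c. intros v. rewrite derives_iff_concl, <- Hc.
  split; intros [w Hw]; exists w;
    rewrite ?psnd_npair, ?pfst_npair, dist_zero in *; exact Hw.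
Qed.

(** * Substitution *)

Definition shift (n : nat) : term := Var (S n).
Definition inst (t : term) : nat -> term := scons t Var.

Fixpoint term_vars (t : term) : nat :=
  match t with
  | Var n => S n
  | Zero => 0
  | Succ t => term_vars t
  | Plus s t | Mult s t => max (term_vars s) (term_vars t)
  end.

(** A strict upper bound on the free variables. *)
Fixpoint vars (phi : formula) : nat :=
  match phi with
  | Bot | Know _ => 0
  | Equal s t => max (term_vars s) (term_vars t)
  | Imp phi psi => max (vars phi) (vars psi)
  | All phi => pred (vars phi)
  end.

Lemma subst_term_ext_vars sigma tau t :
  (forall n, n < term_vars t -> sigma n = tau n) ->
  subst_term sigma t = subst_term tau t.
Proof.
  induction t; simpl; intros H; auto;
    rewrite ?IHt, ?IHt1, ?IHt2; auto; intros; apply H; lia.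
Qed.

Lemma subst_ext_vars sigma tau phi :
  (forall n, n < vars phi -> sigma n = tau n) ->
  subst sigma phi = subst tau phi.
Proof.
  revert sigma tau. induction phi; simpl; intros sigma tau H; auto; f_equal.
  1, 2: apply subst_term_ext_vars; intros; apply H; lia.
  - apply IHphi1. intros; apply H; lia.
  - apply IHphi2. intros; apply H; lia.
  - apply IHphi. intros [|n] Hn; simpl; [reflexivity|].
    rewrite H; [reflexivity | lia].
Qed.

Lemma subst_term_ext sigma tau t :
  (forall n, sigma n = tau n) -> subst_term sigma t = subst_term tau t.
Proof. intros H. apply subst_term_ext_vars. auto. Qed.

Lemma subst_ext sigma tau phi :
  (forall n, sigma n = tau n) -> subst sigma phi = subst tau phi.
Proof. intros H. apply subst_ext_vars. auto. Qed.

Lemma subst_term_comp sigma tau t :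
  subst_term sigma (subst_term tau t)
  = subst_term (fun n => subst_term sigma (tau n)) t.
Proof. induction t; simpl; congruence. Qed.

Lemma subst_comp sigma tau phi :
  subst sigma (subst tau phi) = subst (fun n => subst_term sigma (tau n)) phi.
Proof.
  revert sigma tau. induction phi; simpl; intros sigma tau;
    rewrite ?subst_term_comp, ?IHphi1, ?IHphi2, ?IHphi; auto.
  f_equal. apply subst_ext. intros [|n]; simpl; [reflexivity|].
  now rewrite !subst_term_comp.
Qed.

Lemma subst_term_id t : subst_term Var t = t.
Proof. induction t; simpl; congruence. Qed.

Lemma subst_id sigma phi : (forall n, sigma n = Var n) -> subst sigma phi = phi.
Proof.
  revert sigma. induction phi; simpl; intros sigma H; f_equal; auto.
  1, 2: rewrite <- subst_term_id; now apply subst_term_ext.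
  apply IHphi. intros [|n]; simpl; [reflexivity | now rewrite H].
Qed.

Lemma subst_term_inst_shift t u : subst_term (inst u) (subst_term shift t) = t.
Proof. rewrite subst_term_comp. apply subst_term_id. Qed.

Lemma subst_inst sigma t phi :
  subst sigma (subst (inst t) phi)
  = subst (inst (subst_term sigma t)) (subst (up sigma) phi).
Proof.
  rewrite !subst_comp. apply subst_ext. intros [|n]; simpl; [reflexivity|].
  symmetry. apply subst_term_inst_shift.
Qed.

Lemma subst_up_shift sigma phi :
  subst (up sigma) (subst shift phi) = subst shift (subst sigma phi).
Proof. rewrite !subst_comp. now apply subst_ext. Qed.

Lemma subst_inst_up sigma t phi :
  subst (inst t) (subst (up sigma) phi) = subst (scons t sigma) phi.
Proof.
  rewrite subst_comp. apply subst_ext. intros [|n]; simpl; [reflexivity|].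
  apply subst_term_inst_shift.
Qed.

Lemma eval_term_ext (M : structure) (rho rho' : nat -> M) t :
  (forall n, rho n = rho' n) -> eval_term M rho t = eval_term M rho' t.
Proof. intros H. induction t; simpl; congruence. Qed.

Lemma sat_ext (M : structure) (rho rho' : nat -> M) phi :
  (forall n, rho n = rho' n) -> sat M rho phi <-> sat M rho' phi.
Proof.
  revert rho rho'. induction phi; simpl; intros rho rho' H; try tauto.
  - now rewrite !(eval_term_ext M rho rho').
  - now rewrite (IHphi1 rho rho'), (IHphi2 rho rho').
  - split; intros Hx x; eapply IHphi; try apply (Hx x);
      intros [|n]; simpl; auto.
Qed.

Lemma eval_subst_term (M : structure) (rho : nat -> M) sigma t :
  eval_term M rho (subst_term sigma t)
  = eval_term M (fun n => eval_term M rho (sigma n)) t.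
Proof. induction t; simpl; congruence. Qed.

Lemma sat_subst (M : structure) (rho : nat -> M) sigma phi :
  sat M rho (subst sigma phi)
  <-> sat M (fun n => eval_term M rho (sigma n)) phi.
Proof.
  revert rho sigma. induction phi; simpl; intros rho sigma; try tauto.
  - now rewrite !eval_subst_term.
  - now rewrite IHphi1, IHphi2.
  - split; intros H x; specialize (H x);
      [rewrite IHphi in H | rewrite IHphi];
      (eapply sat_ext; [|exact H]); intros [|n]; simpl; auto;
      now rewrite eval_subst_term.
Qed.

(** * Gödel numbers determine expressions *)

Ltac npair_inv :=
  repeat match goal with
  | H : npair _ _ = npair _ _ |- _ =>
      apply npair_inj in H; destruct H; try discriminate
  end.

Lemma godel_term_inj s t : godel_term s = godel_term t -> s = t.
Proof.
  revert t. induction s; intros []; cbn [godel_term]; intros H; npair_inv;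
    f_equal; auto.
Qed.

Lemma godel_inj phi psi : godel phi = godel psi -> phi = psi.
Proof.
  revert psi. induction phi; intros []; cbn [godel]; intros H; npair_inv;
    f_equal; auto using godel_term_inj.
Qed.

Definition formula_of (n : nat) : formula :=
  epsilon (inhabits Bot) (fun phi => godel phi = n).

Lemma formula_of_godel phi : formula_of (godel phi) = phi.
Proof.
  apply godel_inj, (epsilon_spec (inhabits Bot) (fun psi => godel psi = godel phi)).
  now exists phi.
Qed.

(** * A Hilbert calculus *)

Inductive logical_axiom : formula -> Prop :=
| log_K phi psi : logical_axiom (Imp phi (Imp psi phi))
| log_S phi psi chi :
    logical_axiom (Imp (Imp phi (Imp psi chi))
                     (Imp (Imp phi psi) (Imp phi chi)))
| log_dne phi : logical_axiom (Imp (Neg (Neg phi)) phi)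
| log_all_imp phi psi :
    logical_axiom (Imp (All (Imp phi psi)) (Imp (All phi) (All psi)))
| log_all_intro phi : logical_axiom (Imp phi (All (subst shift phi)))
| log_all_elim phi t : logical_axiom (Imp (All phi) (subst (inst t) phi))
| log_refl t : logical_axiom (Equal t t)
| log_leibniz phi s t :
    logical_axiom (Imp (Equal s t)
                     (Imp (subst (inst s) phi) (subst (inst t) phi))).

Inductive provable : formula -> Prop :=
| provable_axiom phi : logical_axiom phi -> provable phi
| provable_mp phi psi : provable (Imp phi psi) -> provable phi -> provable psi
| provable_gen phi : provable phi -> provable (All phi).

(** Renaming free variables in a proof is what makes them usable as fresh
    constants. *)
Lemma provable_subst phi : provable phi -> forall sigma, provable (subst sigma phi).
Proof.
  induction 1 as [phi Hphi|phi psi _ IH1 _ IH2|phi _ IH]; intros sigma; simpl.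
  - apply provable_axiom.
    destruct Hphi; simpl; rewrite ?subst_inst, ?subst_up_shift; constructor.
  - eapply provable_mp; [apply IH1 | apply IH2].
  - apply provable_gen, IH.
Qed.

(** Generalization is confined to [provable], so that the deduction theorem
    holds without a condition on variables. *)
Inductive entails (Gamma : formula -> Prop) : formula -> Prop :=
| entails_hyp phi : Gamma phi -> entails Gamma phi
| entails_provable phi : provable phi -> entails Gamma phi
| entails_mp phi psi :
    entails Gamma (Imp phi psi) -> entails Gamma phi -> entails Gamma psi.

Lemma entails_axiom Gamma phi : logical_axiom phi -> entails Gamma phi.
Proof. intros. now apply entails_provable, provable_axiom. Qed.

Lemma entails_weaken (Gamma Delta : formula -> Prop) phi :
  (forall psi, Gamma psi -> Delta psi) -> entails Gamma phi -> entails Delta phi.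
Proof. intros H. induction 1; eauto using entails. Qed.

Lemma entails_const Gamma phi psi : entails Gamma psi -> entails Gamma (Imp phi psi).
Proof.
  intros H. eapply entails_mp; [|exact H]. apply entails_axiom. constructor.
Qed.

Lemma entails_id Gamma phi : entails Gamma (Imp phi phi).
Proof.
  eapply entails_mp; [eapply entails_mp|]; apply entails_axiom;
    [apply (log_S phi (Imp phi phi) phi) | apply log_K | apply log_K].
Qed.

Lemma deduction (Gamma : formula -> Prop) phi psi :
  entails (fun chi => chi = phi \/ Gamma chi) psi -> entails Gamma (Imp phi psi).
Proof.
  induction 1 as [chi [->|H]|chi H|chi chi' _ IH1 _ IH2].
  - apply entails_id.
  - now apply entails_const, entails_hyp.
  - now apply entails_const, entails_provable.
  - eapply entails_mp; [eapply entails_mp; [|exact IH1] | exact IH2].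
    apply entails_axiom. constructor.
Qed.

Definition from (L : list formula) (phi : formula) : Prop :=
  entails (fun psi => In psi L) phi.

Lemma from_deduction phi L psi : from (phi :: L) psi -> from L (Imp phi psi).
Proof.
  intros H. apply deduction. eapply entails_weaken; [|exact H].
  simpl. intros chi [->|]; auto.
Qed.

Fixpoint imps (L : list formula) (phi : formula) : formula :=
  match L with
  | [] => phi
  | psi :: L => imps L (Imp psi phi)
  end.

Lemma from_imps L phi : from L phi -> provable (imps L phi).
Proof.
  revert phi. induction L as [|psi L IH]; simpl; intros phi H.
  - induction H as [phi []|phi H|phi psi _ IH1 _ IH2]; eauto using provable.
  - now apply IH, from_deduction.
Qed.

(** Generalization under hypotheses, by distributing the quantifier over the
    implications. *)
Lemma from_all_imps L phi :
  provable (All (imps (map (subst shift) L) phi)) -> from L (All phi).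
Proof.
  revert phi. induction L as [|psi L IH]; simpl; intros phi H.
  - now apply entails_provable.
  - apply IH in H. eapply entails_mp; [eapply entails_mp|].
    + apply entails_axiom, (log_all_imp (subst shift psi) phi).
    + eapply entails_weaken; [|exact H]. simpl. auto.
    + eapply entails_mp; [apply entails_axiom, log_all_intro|].
      apply entails_hyp. now left.
Qed.

Lemma subst_imps sigma L phi :
  subst sigma (imps L phi) = imps (map (subst sigma) L) (subst sigma phi).
Proof. revert phi. induction L; simpl; auto. Qed.

(** The eigenvariable [c] is renamed to the index 0 and the other variables
    are moved up, after which the generalization rule applies. *)
Lemma from_generalize L phi c :
  (forall psi, In psi L -> vars psi <= c) -> vars phi <= c ->
  from L (subst (inst (Var c)) phi) -> from L (All phi).
Proof.
  intros HL Hphi H. apply from_all_imps, provable_gen.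
  apply from_imps in H.
  apply (fun H => provable_subst _ H
          (fun n => if Nat.eqb n c then Var 0 else Var (S n))) in H.
  rewrite subst_imps, subst_comp in H.
  rewrite (map_ext_in _ (subst shift)) in H.
  - rewrite (subst_ext_vars _ Var phi), subst_id in H; auto.
    intros [|n] Hn; simpl.
    + now rewrite Nat.eqb_refl.
    + destruct (Nat.eqb_spec n c); [lia | reflexivity].
  - intros psi Hpsi. apply subst_ext_vars. intros n Hn.
    destruct (Nat.eqb_spec n c) as [->|]; [|reflexivity].
    specialize (HL psi Hpsi). lia.
Qed.

(** * Completeness *)

Definition consistent (L : list formula) : Prop := ~ from L Bot.

Definition fresh (L : list formula) : nat := list_max (map vars L).

Lemma fresh_spec L psi : In psi L -> vars psi <= fresh L.
Proof.
  intros H. pose proof (proj1 (list_max_le (map vars L) _) (le_n _)) as Hmax.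
  rewrite Forall_forall in Hmax. now apply Hmax, in_map.
Qed.

(** If a universal formula has to be rejected, a counterexample is added; the
    witness can be any variable not occurring so far. *)
Definition extend (L : list formula) (psi : formula) : list formula :=
  if excluded_middle_informative (consistent (psi :: L)) then psi :: L
  else match psi with
       | All phi => Neg (subst (inst (Var (fresh (phi :: L)))) phi) :: L
       | _ => L
       end.

Lemma extend_consistent L psi : consistent L -> consistent (extend L psi).
Proof.
  intros HL. unfold extend.
  destruct (excluded_middle_informative _) as [H|H]; [exact H|].
  destruct psi as [| | |phi|]; try exact HL.
  intros Hbot. apply from_deduction in Hbot. apply NNPP in H.
  apply from_deduction in H. apply HL. eapply entails_mp; [exact H|].
  apply from_generalize with (fresh (phi :: L)).
  - intros chi Hchi. apply fresh_spec. now right.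
  - apply fresh_spec. now left.
  - eapply entails_mp; [apply entails_axiom, log_dne | exact Hbot].
Qed.

Lemma extend_incl L psi chi : In chi L -> In chi (extend L psi).
Proof.
  intros H. unfold extend. destruct (excluded_middle_informative _).
  - now right.
  - destruct psi; auto. now right.
Qed.

Fixpoint stage (phi : formula) (n : nat) : list formula :=
  match n with
  | 0 => [phi]
  | S n => extend (stage phi n) (formula_of n)
  end.

Lemma stage_consistent phi n : consistent [phi] -> consistent (stage phi n).
Proof. intros H. induction n; simpl; auto using extend_consistent. Qed.

Lemma stage_incl phi n m psi :
  n <= m -> In psi (stage phi n) -> In psi (stage phi m).
Proof. induction 1; simpl; auto using extend_incl. Qed.

(** For consistent [phi] this is a maximal consistent set in which every rejected
    universal formula has a variable as a counterexample. *)
Definition henkin (phi psi : formula) : Prop := exists n, In psi (stage phi n).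

Lemma henkin_compact phi psi :
  entails (henkin phi) psi -> exists n, from (stage phi n) psi.
Proof.
  induction 1 as [psi [n H]|psi H|psi chi _ [n IHn] _ [m IHm]].
  - exists n. now apply entails_hyp.
  - exists 0. now apply entails_provable.
  - exists (max n m). eapply entails_mp.
    + eapply entails_weaken; [|exact IHn]. intros x. apply stage_incl. lia.
    + eapply entails_weaken; [|exact IHm]. intros x. apply stage_incl. lia.
Qed.

Section Henkin.

Context (phi0 : formula) (Hphi0 : consistent [phi0]).
Let T := henkin phi0.

Lemma henkin_consistent : ~ entails T Bot.
Proof.
  intros [n H]%henkin_compact. now apply (stage_consistent _ n Hphi0).
Qed.

Lemma stage_godel psi :
  stage phi0 (S (godel psi)) = extend (stage phi0 (godel psi)) psi.
Proof. simpl. now rewrite formula_of_godel. Qed.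

Lemma henkin_rejects psi :
  ~ T psi -> ~ consistent (psi :: stage phi0 (godel psi)).
Proof.
  intros H Hc. apply H. exists (S (godel psi)). rewrite stage_godel.
  unfold extend. destruct (excluded_middle_informative _); [now left | easy].
Qed.

Lemma henkin_refutes psi : ~ T psi -> entails T (Neg psi).
Proof.
  intros H%henkin_rejects. apply NNPP, from_deduction in H.
  eapply entails_weaken; [|exact H]. intros chi Hchi. now exists (godel psi).
Qed.

Lemma henkin_counterexample phi :
  ~ T (All phi) -> exists t, T (Neg (subst (inst t) phi)).
Proof.
  intros H%henkin_rejects.
  exists (Var (fresh (phi :: stage phi0 (godel (All phi))))).
  exists (S (godel (All phi))). rewrite stage_godel. unfold extend.
  destruct (excluded_middle_informative _); [easy | now left].
Qed.

Lemma henkin_closed psi : entails T psi -> T psi.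
Proof.
  intros H. apply NNPP. intros Hn%henkin_refutes.
  apply henkin_consistent. eapply entails_mp; eassumption.
Qed.

Lemma henkin_mp phi psi : T (Imp phi psi) -> T phi -> T psi.
Proof.
  intros H1 H2. apply henkin_closed. eapply entails_mp; apply entails_hyp; eauto.
Qed.

Lemma henkin_axiom phi : logical_axiom phi -> T phi.
Proof. intros H. now apply henkin_closed, entails_axiom. Qed.

Lemma henkin_bot : ~ T Bot.
Proof. intros H. now apply henkin_consistent, entails_hyp. Qed.

Lemma henkin_neg psi : ~ T psi -> T (Neg psi).
Proof. intros H. now apply henkin_closed, henkin_refutes. Qed.

Lemma henkin_imp phi psi : T (Imp phi psi) <-> (T phi -> T psi).
Proof.
  split; [apply henkin_mp|]. intros H.
  destruct (classic (T psi)) as [Hpsi|Hpsi].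
  - eapply henkin_mp; [|exact Hpsi]. apply henkin_axiom. constructor.
  - assert (Hn : T (Neg phi)) by (apply henkin_neg; tauto).
    apply henkin_closed, deduction.
    eapply entails_mp; [apply entails_axiom, log_dne|].
    apply entails_const.
    eapply entails_mp; apply entails_hyp; [right; exact Hn | now left].
Qed.

Lemma henkin_all phi : T (All phi) <-> forall t, T (subst (inst t) phi).
Proof.
  split.
  - intros H t. eapply henkin_mp; [|exact H]. apply henkin_axiom. constructor.
  - intros H. apply NNPP. intros [t Ht]%henkin_counterexample.
    eapply henkin_bot, henkin_mp; [exact Ht | apply H].
Qed.

Lemma henkin_refl t : T (Equal t t).
Proof. apply henkin_axiom. constructor. Qed.

Lemma henkin_leibniz phi s t :
  T (Equal s t) -> T (subst (inst s) phi) -> T (subst (inst t) phi).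
Proof.
  intros H1 H2. eapply henkin_mp; [|exact H2]. eapply henkin_mp; [|exact H1].
  apply henkin_axiom. constructor.
Qed.

Lemma henkin_sym s t : T (Equal s t) -> T (Equal t s).
Proof.
  intros H.
  pose proof (henkin_leibniz (Equal (Var 0) (subst_term shift s)) s t H) as H'.
  simpl in H'. rewrite !subst_term_inst_shift in H'. apply H', henkin_refl.
Qed.

(** Congruence for a context [C], whose hole is the index 0. *)
Lemma henkin_congr (C : term) s t :
  T (Equal s t) ->
  T (Equal (subst_term (inst s) C) (subst_term (inst t) C)).
Proof.
  intros H.
  pose proof (henkin_leibniz
    (Equal (subst_term shift (subst_term (inst s) C)) C) s t H) as H'.
  simpl in H'. rewrite !subst_term_inst_shift in H'. apply H', henkin_refl.
Qed.

Lemma henkin_trans r s t : T (Equal r s) -> T (Equal s t) -> T (Equal r t).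
Proof.
  intros H1 H2.
  pose proof (henkin_leibniz (Equal (subst_term shift r) (Var 0)) s t H2) as H'.
  simpl in H'. rewrite !subst_term_inst_shift in H'. auto.
Qed.

(** Equivalence classes are represented by predicates, so that provably equal
    terms become equal elements. *)
Definition class_type : Type :=
  { P : term -> Prop | exists t, P = fun s => T (Equal t s) }.

Lemma class_type_eq (x y : class_type) : proj1_sig x = proj1_sig y -> x = y.
Proof. apply eq_sig_hprop. intros. apply proof_irrelevance. Qed.

Definition class (t : term) : class_type :=
  exist _ (fun s => T (Equal t s)) (ex_intro _ t eq_refl).

Lemma class_eq s t : class s = class t <-> T (Equal s t).
Proof.
  split.
  - intros [= H]. rewrite (equal_f H t). apply henkin_refl.
  - intros H. apply class_type_eq. extensionality u.
    apply propositional_extensionality. split; intros Hu.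
    + now apply henkin_trans with s; [apply henkin_sym|].
    + now apply henkin_trans with t.
Qed.

Definition repr (x : class_type) : term :=
  epsilon (inhabits Zero) (fun t => class t = x).

Lemma class_repr x : class (repr x) = x.
Proof.
  unfold repr. apply (epsilon_spec (inhabits Zero) (fun t => class t = x)).
  destruct x as [P [t E]]. exists t. now apply class_type_eq.
Qed.

Definition term_model : structure :=
  {| carrier := class_type;
     i_zero := class Zero;
     i_succ x := class (Succ (repr x));
     i_plus x y := class (Plus (repr x) (repr y));
     i_mult x y := class (Mult (repr x) (repr y));
     i_know phi := T (Know phi) |}.

Lemma eval_term_model (sigma : nat -> term) t :
  eval_term term_model (fun n => class (sigma n)) t = class (subst_term sigma t).
Proof.
  assert (Hr : forall s, T (Equal (repr (class s)) s)).
  { intros s. apply class_eq, class_repr. }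
  induction t as [n| |t IH|s IHs t IHt|s IHs t IHt]; simpl;
    rewrite ?IH, ?IHs, ?IHt; try reflexivity; apply class_eq.
  - apply (henkin_congr (Succ (Var 0)) _ _ (Hr _)).
  (* The two arguments are replaced one after the other. *)
  - pose proof (henkin_congr (Plus (Var 0) (subst_term shift
      (repr (class (subst_term sigma t))))) _ _ (Hr (subst_term sigma s))) as H1.
    pose proof (henkin_congr (Plus (subst_term shift (subst_term sigma s))
      (Var 0)) _ _ (Hr (subst_term sigma t))) as H2.
    simpl in H1, H2. rewrite !subst_term_inst_shift in H1, H2.
    exact (henkin_trans _ _ _ H1 H2).
  - pose proof (henkin_congr (Mult (Var 0) (subst_term shift
      (repr (class (subst_term sigma t))))) _ _ (Hr (subst_term sigma s))) as H1.
    pose proof (henkin_congr (Mult (subst_term shift (subst_term sigma s))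
      (Var 0)) _ _ (Hr (subst_term sigma t))) as H2.
    simpl in H1, H2. rewrite !subst_term_inst_shift in H1, H2.
    exact (henkin_trans _ _ _ H1 H2).
Qed.

(** Truth lemma.  The substitution [sigma] serves as an assignment, which lets
    the induction pass under binders. *)
Lemma sat_term_model phi (sigma : nat -> term) :
  sat term_model (fun n => class (sigma n)) phi <-> T (subst sigma phi).
Proof.
  revert sigma. induction phi as [|s t|phi IH1 psi IH2|phi IH|phi _]; intros sigma.
  - simpl. split; [easy | apply henkin_bot].
  - cbn [sat]. rewrite !eval_term_model. apply class_eq.
  - cbn [sat subst]. now rewrite IH1, IH2, henkin_imp.
  - cbn [sat subst]. rewrite henkin_all.
    assert (H : forall t, sat term_model (scons (class t) (fun n => class (sigma n))) phi
                          <-> T (subst (inst t) (subst (up sigma) phi))).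
    { intros t. rewrite subst_inst_up, <- IH. apply sat_ext.
      now intros [|n]. }
    split; intros Hall.
    + intros t. apply H, Hall.
    + intros x. rewrite <- (class_repr x). apply H, Hall.
  - reflexivity.
Qed.

Lemma sat_initial : sat term_model (fun n => class (Var n)) phi0.
Proof.
  apply (sat_term_model phi0 Var). rewrite subst_id by reflexivity.
  exists 0. now left.
Qed.

End Henkin.

Theorem completeness phi : valid phi -> provable phi.
Proof.
  intros Hvalid. apply NNPP. intros Hn.
  assert (Hc : consistent [Neg phi]).
  { intros H%from_deduction. apply Hn, (from_imps []).
    eapply entails_mp; [apply entails_axiom, log_dne | exact H]. }
  apply (sat_initial _ Hc). apply Hvalid.
Qed.

(** * The theory of the knowing machine *)

Definition peano_axioms : list formula :=
  [ All (Neg (Equal (Succ (Var 0)) Zero));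
    All (All (Imp (Equal (Succ (Var 1)) (Succ (Var 0))) (Equal (Var 1) (Var 0))));
    All (Equal (Plus (Var 0) Zero) (Var 0));
    All (All (Equal (Plus (Var 1) (Succ (Var 0)))
                (Succ (Plus (Var 1) (Var 0)))));
    All (Equal (Mult (Var 0) Zero) Zero);
    All (All (Equal (Mult (Var 1) (Succ (Var 0)))
                (Plus (Mult (Var 1) (Var 0)) (Var 1)))) ].

(** Induction is taken for all formulas of the language with K: in the
    intended structure a formula K(phi) is just a proposition.  The rule
    [knows_know] makes K(phi) a theorem for the theorems phi, as the closure
    schema demands when phi is valid or an axiom of arithmetic. *)
Inductive knows (e : nat) : formula -> Prop :=
| knows_logic phi : logical_axiom phi -> knows e phi
| knows_mp phi psi : knows e (Imp phi psi) -> knows e phi -> knows e psi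
| knows_gen phi : knows e phi -> knows e (All phi)
| knows_know phi : knows e phi -> knows e (Know phi)
| knows_peano phi : In phi peano_axioms -> knows e phi
| knows_induction phi : knows e (induction phi)
| knows_know_mp phi psi :
    knows e (Imp (Know (Imp phi psi)) (Imp (Know phi) (Know psi)))
| knows_index phi : knows e (Iff (Know phi) (mem_W e (godel phi))).

(** * Quoting formulas with holes *)

Fixpoint fill_term (f : nat -> term) (t : term) : term :=
  match t with
  | Var n => f n
  | Zero => Zero
  | Succ t => Succ (fill_term f t)
  | Plus s t => Plus (fill_term f s) (fill_term f t)
  | Mult s t => Mult (fill_term f s) (fill_term f t)
  end.

(** Unlike [subst], [fill] does not shift indices under binders.  It fills holes,
    marked by indices that are not used otherwise, with closed terms. *)
Fixpoint fill (f : nat -> term) (phi : formula) : formula :=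
  match phi with
  | Bot => Bot
  | Equal s t => Equal (fill_term f s) (fill_term f t)
  | Imp phi psi => Imp (fill f phi) (fill f psi)
  | All phi => All (fill f phi)
  | Know phi => Know (fill f phi)
  end.

Fixpoint pnum (n : nat) : pattern :=
  match n with
  | 0 => PZero
  | S n => PSucc (pnum n)
  end.

Definition tagged (k : nat) (p : pattern) : pattern := PPair (pnum k) p.

Definition pImp (p q : pattern) : pattern := tagged 2 (PPair p q).
Definition pAll (p : pattern) : pattern := tagged 3 p.
Definition pKnow (p : pattern) : pattern := tagged 4 p.
Definition pNeg (p : pattern) : pattern := pImp p (tagged 0 PZero).
Definition pIff (p q : pattern) : pattern :=
  pNeg (pImp (pImp p q) (pNeg (pImp q p))).

Fixpoint quote_term (h : nat -> pattern) (t : term) : pattern :=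
  match t with
  | Var n => h n
  | Zero => tagged 1 PZero
  | Succ t => tagged 2 (quote_term h t)
  | Plus s t => tagged 3 (PPair (quote_term h s) (quote_term h t))
  | Mult s t => tagged 4 (PPair (quote_term h s) (quote_term h t))
  end.

Fixpoint quote (h : nat -> pattern) (phi : formula) : pattern :=
  match phi with
  | Bot => tagged 0 PZero
  | Equal s t => tagged 1 (PPair (quote_term h s) (quote_term h t))
  | Imp phi psi => pImp (quote h phi) (quote h psi)
  | All phi => pAll (quote h phi)
  | Know phi => pKnow (quote h phi)
  end.

Lemma peval_pnum rho n : peval rho (pnum n) = n.
Proof. induction n; simpl; congruence. Qed.

Lemma peval_quote rho h f phi :
  (forall n, peval rho (h n) = godel_term (f n)) ->
  peval rho (quote h phi) = godel (fill f phi).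
Proof.
  intros H.
  assert (Ht : forall t, peval rho (quote_term h t) = godel_term (fill_term f t)).
  { induction t; simpl; rewrite ?IHt, ?IHt1, ?IHt2; auto. }
  induction phi; simpl; rewrite ?Ht, ?IHphi, ?IHphi1, ?IHphi2; auto.
Qed.

Definition pvar (n : nat) : pattern := tagged 0 (pnum n).

Lemma peval_quote_closed rho phi : peval rho (quote pvar phi) = godel phi.
Proof.
  rewrite (peval_quote _ _ Var).
  - f_equal.
    assert (Ht : forall t, fill_term Var t = t) by (induction t; simpl; congruence).
    induction phi; simpl; rewrite ?Ht; congruence.
  - intros n. simpl. now rewrite peval_pnum.
Qed.

(** [mem_W] with arbitrary terms in place of the two numerals: the axioms about
    W_e differ only in these, so a single pattern generates them. *)
Definition mem_W_at (e n : dterm) : formula :=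
  dex (fun a => dex (fun b => dex (fun l => dex (fun y =>
    dand (ditem a b l e n y)
      (dall (fun i => dimp (dlt i (dsucc l))
        (dex (fun c => dex (fun x => dex (fun z =>
          dand (ditem a b i c x z) (dstep (dearlier a b i) c x z)))))))))))  0.

(* Any indices above those of the bound variables of [mem_W_at] will do. *)
Definition mem_W_skeleton : formula :=
  mem_W_at (fun _ => Var 100) (fun _ => Var 101).

Definition holes {X : Type} (x y : X) (z : nat -> X) (n : nat) : X :=
  if Nat.eqb n 100 then x else if Nat.eqb n 101 then y else z n.

Lemma fill_mem_W_skeleton e n :
  fill (holes (numeral e) (numeral n) Var) mem_W_skeleton = mem_W e n.
Proof. reflexivity. Qed.

Definition pmem_W (p q : pattern) : pattern := quote (holes p q pvar) mem_W_skeleton.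

Lemma peval_pmem_W rho p q e n :
  peval rho p = godel_term (numeral e) -> peval rho q = godel_term (numeral n) ->
  peval rho (pmem_W p q) = godel (mem_W e n).
Proof.
  intros Hp Hq. rewrite <- fill_mem_W_skeleton. apply peval_quote.
  intros k. unfold holes. destruct (Nat.eqb k 100), (Nat.eqb k 101); auto.
  all: simpl; now rewrite peval_pnum.
Qed.

(** * The theory as a logic program *)

(** Substitutions are functions on all variables, so a clause can only refer to
    them by name.  These are the ones that occur in axioms, closed under [up]. *)
Inductive sname : Type :=
| Shift
| Inst (t : term)
| Next
| Up (s : sname).

Fixpoint sval (s : sname) : nat -> term :=
  match s with
  | Shift => shift
  | Inst t => inst t
  | Next => scons (Succ (Var 0)) (fun n => Var (S n))
  | Up s => up (sval s)
  end.

Fixpoint godel_sname (s : sname) : nat :=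
  match s with
  | Shift => npair 0 0
  | Inst t => npair 1 (godel_term t)
  | Next => npair 2 0
  | Up s => npair 3 (godel_sname s)
  end.

Definition pShift : pattern := tagged 0 PZero.
Definition pInst (p : pattern) : pattern := tagged 1 p.
Definition pNext : pattern := tagged 2 PZero.
Definition pUp (p : pattern) : pattern := tagged 3 p.

(** Judgements are tagged so that one set of clauses can derive all of them. *)
Definition jTerm (p : pattern) : pattern := tagged 0 p.
Definition jFormula (p : pattern) : pattern := tagged 1 p.
Definition jNumeral (n p : pattern) : pattern := tagged 2 (PPair n p).
Definition jVar (s n p : pattern) : pattern := tagged 3 (PPair s (PPair n p)).
Definition jSubstTerm (s p q : pattern) : pattern :=
  tagged 4 (PPair s (PPair p q)).
Definition jSubst (s p q : pattern) : pattern := tagged 5 (PPair s (PPair p q)).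
Definition jKnows (e p : pattern) : pattern := tagged 6 (PPair e p).

(** A judgement about a substitution speaks of all substitutions with the name
    [s], rather than of some, because clauses such as [subst_zero] instantiate
    [s] by arbitrary numbers. *)
Definition meaning (k x : nat) : Prop :=
  match k with
  | 0 => exists t, x = godel_term t
  | 1 => exists phi, x = godel phi
  | 2 => exists n, x = npair n (godel_term (numeral n))
  | 3 => exists s n u, x = npair s (npair n u) /\
           forall sigma, s = godel_sname sigma -> u = godel_term (sval sigma n)
  | 4 => exists s t u, x = npair s (npair (godel_term t) u) /\
           forall sigma, s = godel_sname sigma ->
             u = godel_term (subst_term (sval sigma) t)
  | 5 => exists s phi u, x = npair s (npair (godel phi) u) /\
           forall sigma, s = godel_sname sigma ->
             u = godel (subst (sval sigma) phi)
  | 6 => exists e phi, x = npair e (godel phi) /\ knows e phi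
  | _ => False
  end.

Definition holds (v : nat) : Prop := meaning (pfst v) (psnd v).

Lemma holds_npair k x : holds (npair k x) = meaning k x.
Proof. unfold holds. now rewrite pfst_npair, psnd_npair. Qed.

(** Naming the clauses makes it possible to refer to them without their
    positions in the program. *)
Inductive rule_name : Type :=
| term_var | term_zero | term_succ | term_plus | term_mult
| formula_bot | formula_equal | formula_imp | formula_all | formula_know
| numeral_zero | numeral_succ
| var_shift | var_inst_0 | var_inst_S | var_next_0 | var_next_S
| var_up_0 | var_up_S
| subst_var | subst_zero | subst_succ | subst_plus | subst_mult
| subst_bot | subst_equal | subst_imp | subst_all | subst_know
| rule_K | rule_S | rule_dne | rule_all_imp | rule_all_intro | rule_all_elim
| rule_refl | rule_leibniz | rule_mp | rule_gen | rule_know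
| rule_peano_0 | rule_peano_1 | rule_peano_2 | rule_peano_3 | rule_peano_4
| rule_peano_5 | rule_induction | rule_know_mp | rule_index.

(** In the clauses for theorems, the premises [jTerm] and [jFormula] restrict the
    schematic variables to Gödel numbers. *)
Definition rule (r : rule_name) : clause :=
  let a := PVar 0 in let b := PVar 1 in let c := PVar 2 in
  let a' := PVar 3 in let b' := PVar 4 in let s := PVar 5 in let e := PVar 6 in
  let peano k :=
    Clause [] (jKnows e (quote pvar (nth k peano_axioms Bot))) in
  match r with
  | term_var => Clause [] (jTerm (tagged 0 a))
  | term_zero => Clause [] (jTerm (tagged 1 PZero))
  | term_succ => Clause [jTerm a] (jTerm (tagged 2 a))
  | term_plus => Clause [jTerm a; jTerm b] (jTerm (tagged 3 (PPair a b)))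
  | term_mult => Clause [jTerm a; jTerm b] (jTerm (tagged 4 (PPair a b)))
  | formula_bot => Clause [] (jFormula (tagged 0 PZero))
  | formula_equal =>
      Clause [jTerm a; jTerm b] (jFormula (tagged 1 (PPair a b)))
  | formula_imp => Clause [jFormula a; jFormula b] (jFormula (pImp a b))
  | formula_all => Clause [jFormula a] (jFormula (pAll a))
  | formula_know => Clause [jFormula a] (jFormula (pKnow a))
  | numeral_zero => Clause [] (jNumeral PZero (tagged 1 PZero))
  | numeral_succ => Clause [jNumeral a b] (jNumeral (PSucc a) (tagged 2 b))
  | var_shift => Clause [] (jVar pShift a (tagged 0 (PSucc a)))
  | var_inst_0 => Clause [] (jVar (pInst a) PZero a)
  | var_inst_S => Clause [] (jVar (pInst a) (PSucc b) (tagged 0 b))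
  | var_next_0 => Clause [] (jVar pNext PZero (tagged 2 (tagged 0 PZero)))
  | var_next_S => Clause [] (jVar pNext (PSucc a) (tagged 0 (PSucc a)))
  | var_up_0 => Clause [] (jVar (pUp s) PZero (tagged 0 PZero))
  | var_up_S =>
      Clause [jVar s a b; jSubstTerm pShift b c] (jVar (pUp s) (PSucc a) c)
  | subst_var => Clause [jVar s a b] (jSubstTerm s (tagged 0 a) b)
  | subst_zero => Clause [] (jSubstTerm s (tagged 1 PZero) (tagged 1 PZero))
  | subst_succ =>
      Clause [jSubstTerm s a a'] (jSubstTerm s (tagged 2 a) (tagged 2 a'))
  | subst_plus =>
      Clause [jSubstTerm s a a'; jSubstTerm s b b']
        (jSubstTerm s (tagged 3 (PPair a b)) (tagged 3 (PPair a' b')))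
  | subst_mult =>
      Clause [jSubstTerm s a a'; jSubstTerm s b b']
        (jSubstTerm s (tagged 4 (PPair a b)) (tagged 4 (PPair a' b')))
  | subst_bot => Clause [] (jSubst s (tagged 0 PZero) (tagged 0 PZero))
  | subst_equal =>
      Clause [jSubstTerm s a a'; jSubstTerm s b b']
        (jSubst s (tagged 1 (PPair a b)) (tagged 1 (PPair a' b')))
  | subst_imp =>
      Clause [jSubst s a a'; jSubst s b b'] (jSubst s (pImp a b) (pImp a' b'))
  | subst_all => Clause [jSubst (pUp s) a a'] (jSubst s (pAll a) (pAll a'))
  | subst_know => Clause [jFormula a] (jSubst s (pKnow a) (pKnow a))
  | rule_K =>
      Clause [jFormula a; jFormula b] (jKnows e (pImp a (pImp b a)))
  | rule_S =>
      Clause [jFormula a; jFormula b; jFormula c]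
        (jKnows e (pImp (pImp a (pImp b c)) (pImp (pImp a b) (pImp a c))))
  | rule_dne => Clause [jFormula a] (jKnows e (pImp (pNeg (pNeg a)) a))
  | rule_all_imp =>
      Clause [jFormula a; jFormula b]
        (jKnows e (pImp (pAll (pImp a b)) (pImp (pAll a) (pAll b))))
  | rule_all_intro =>
      Clause [jSubst pShift a a'] (jKnows e (pImp a (pAll a')))
  | rule_all_elim =>
      Clause [jTerm b; jSubst (pInst b) a a'] (jKnows e (pImp (pAll a) a'))
  | rule_refl => Clause [jTerm a] (jKnows e (tagged 1 (PPair a a)))
  | rule_leibniz =>
      Clause [jTerm b; jTerm c; jSubst (pInst b) a a'; jSubst (pInst c) a b']
        (jKnows e (pImp (tagged 1 (PPair b c)) (pImp a' b')))
  | rule_mp =>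
      Clause [jFormula b; jKnows e a; jKnows e (pImp a b)] (jKnows e b)
  | rule_gen => Clause [jKnows e a] (jKnows e (pAll a))
  | rule_know => Clause [jKnows e a] (jKnows e (pKnow a))
  | rule_peano_0 => peano 0
  | rule_peano_1 => peano 1
  | rule_peano_2 => peano 2
  | rule_peano_3 => peano 3
  | rule_peano_4 => peano 4
  | rule_peano_5 => peano 5
  | rule_induction =>
      Clause [jSubst (pInst (tagged 1 PZero)) a a'; jSubst pNext a b']
        (jKnows e (pImp a' (pImp (pAll (pImp a b')) (pAll a))))
  | rule_know_mp =>
      Clause [jFormula a; jFormula b]
        (jKnows e (pImp (pKnow (pImp a b)) (pImp (pKnow a) (pKnow b))))
  | rule_index =>
      Clause [jFormula a; jNumeral e b; jNumeral a c]
        (jKnows e (pIff (pKnow a) (pmem_W b c)))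
  end.

Definition program : list clause :=
  map rule
    [ term_var; term_zero; term_succ; term_plus; term_mult;
      formula_bot; formula_equal; formula_imp; formula_all; formula_know;
      numeral_zero; numeral_succ;
      var_shift; var_inst_0; var_inst_S; var_next_0; var_next_S;
      var_up_0; var_up_S;
      subst_var; subst_zero; subst_succ; subst_plus; subst_mult;
      subst_bot; subst_equal; subst_imp; subst_all; subst_know;
      rule_K; rule_S; rule_dne; rule_all_imp; rule_all_intro; rule_all_elim;
      rule_refl; rule_leibniz; rule_mp; rule_gen; rule_know;
      rule_peano_0; rule_peano_1; rule_peano_2; rule_peano_3; rule_peano_4;
      rule_peano_5; rule_induction; rule_know_mp; rule_index ].

Lemma rule_in_program r : In (rule r) program.
Proof. apply in_map. destruct r; simpl; tauto. Qed.

Ltac invert_judgements :=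
  repeat (rewrite holds_npair in *; cbn [meaning] in *);
  repeat match goal with
  | H : exists _, _ |- _ => destruct H
  | H : _ /\ _ |- _ => destruct H
  | H : forall sigma, npair 0 0 = godel_sname sigma -> _ |- _ =>
      specialize (H Shift eq_refl)
  | H : forall sigma, npair 1 (godel_term ?t) = godel_sname sigma -> _ |- _ =>
      specialize (H (Inst t) eq_refl)
  | H : forall sigma, npair 1 (npair 1 0) = godel_sname sigma -> _ |- _ =>
      specialize (H (Inst Zero) eq_refl)
  | H : forall sigma, npair 2 0 = godel_sname sigma -> _ |- _ =>
      specialize (H Next eq_refl)
  | H : npair _ _ = npair _ _ |- _ => apply npair_inj in H
  | H : godel _ = godel _ |- _ => apply godel_inj in H
  | H : godel_term _ = godel_term _ |- _ => apply godel_term_inj in H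
  | _ => progress subst
  end.

Ltac term_of n :=
  match n with
  | godel_term ?t => t
  | npair 0 ?k => constr:(Var k)
  | npair 1 0 => Zero
  | npair 2 ?a => let s := term_of a in constr:(Succ s)
  | npair 3 (npair ?a ?b) =>
      let s := term_of a in let t := term_of b in constr:(Plus s t)
  | npair 4 (npair ?a ?b) =>
      let s := term_of a in let t := term_of b in constr:(Mult s t)
  end.

Ltac expr_of n :=
  match n with
  | godel ?phi => phi
  | npair 0 0 => Bot
  | npair 1 (npair ?a ?b) =>
      let s := term_of a in let t := term_of b in constr:(Equal s t)
  | npair 2 (npair ?a ?b) =>
      let phi := expr_of a in let psi := expr_of b in constr:(Imp phi psi)
  | npair 3 ?a => let phi := expr_of a in constr:(All phi)
  | npair 4 ?a => let phi := expr_of a in constr:(Know phi)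
  end.

(** Finds the syntax coded by the explicit pairs in the goal. *)
Ltac exhibit_syntax :=
  match goal with
  | |- exists t : term, ?n = godel_term t =>
      let t := term_of n in exists t
  | |- exists phi, ?n = godel phi => let phi := expr_of n in exists phi
  | |- exists n, npair ?k _ = npair n (godel_term (numeral n)) => exists k
  | |- exists s n u : nat, npair ?k (npair ?i ?v) = _ /\ _ =>
      exists k, i, v; split
  | |- exists s (t : term) u, npair ?k (npair ?i ?v) = _ /\ _ =>
      let t := term_of i in exists k, t, v; split
  | |- exists s (phi : formula) u, npair ?k (npair ?i ?v) = _ /\ _ =>
      let phi := expr_of i in exists k, phi, v; split
  | |- exists e (phi : formula), npair ?k ?i = _ /\ _ =>
      let phi := expr_of i in exists k, phi; split
  end; try reflexivity.

Lemma rule_sound r rho :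
  fold_right (fun p => and (holds (peval rho p))) True (premises (rule r)) ->
  holds (peval rho (conclusion (rule r))).
Proof.
  destruct r; cbn -[quote pmem_W nth peano_axioms]; rewrite ?peval_quote_closed.
  (* The last rule evaluates a pattern in the instantiation [rho] itself. *)
  49: {
    intros H.
    assert (Hb : rho 1 = godel_term (numeral (rho 6)))
      by (invert_judgements; congruence).
    assert (Hc : rho 2 = godel_term (numeral (rho 0)))
      by (invert_judgements; congruence).
    rewrite (peval_pmem_W rho (PVar 1) (PVar 2) (rho 6) (rho 0) Hb Hc).
    destruct H as [H _]. rewrite holds_npair in *. cbn [meaning] in *.
    destruct H as [phi ->].
    exists (rho 6), (Iff (Know phi) (mem_W (rho 6) (godel phi))).
    split; [reflexivity | apply knows_index]. }
  all: generalize (rho 0) (rho 1) (rho 2) (rho 3) (rho 4) (rho 5) (rho 6);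
    clear rho; intros a b c a' b' s e H; invert_judgements; exhibit_syntax.
  (* Substitution in a variable: the name of the substitution is analysed. *)
  1-7: intros [] E; cbn in E; npair_inv; subst; try reflexivity;
    match goal with H : forall sigma, _ -> godel_term ?t = _ |- _ =>
      now rewrite (godel_term_inj _ _ (H _ eq_refl)) end.
  1-6: intros sigma ->;
    repeat match goal with
    | H : forall tau, godel_sname ?sigma = godel_sname tau -> ?x = _ |- _ =>
        rewrite (H sigma eq_refl); clear H
    end; reflexivity.
  - intros sigma ->.
    match goal with H : forall tau, npair 3 _ = _ -> _ |- _ =>
      now rewrite (H (Up sigma) eq_refl) end.
  - apply knows_logic, log_K.
  - apply knows_logic, log_S.
  - apply knows_logic, log_dne.
  - apply knows_logic, log_all_imp.
  - apply knows_logic, log_all_intro.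
  - apply knows_logic, log_all_elim.
  - apply knows_logic, log_refl.
  - apply knows_logic, log_leibniz.
  - match goal with H : npair 2 (npair (godel ?phi) (godel ?psi)) = _ |- _ =>
      apply (godel_inj (Imp phi psi)) in H; subst end.
    eapply knows_mp; eassumption.
  - now apply knows_gen.
  - now apply knows_know.
  - apply knows_peano; simpl; tauto.
  - apply knows_peano; simpl; tauto.
  - apply knows_peano; simpl; tauto.
  - apply knows_peano; simpl; tauto.
  - apply knows_peano; simpl; tauto.
  - apply knows_peano; simpl; tauto.
  - apply knows_induction.
  - apply knows_know_mp.
Qed.

Lemma derives_sound v : derives program v -> holds v.
Proof.
  induction 1 as [C rho HC _ IH].
  apply in_map_iff in HC. destruct HC as (r & <- & _). apply rule_sound.
  induction (premises (rule r)) as [|p ps IHps]; simpl; [exact I|].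
  split; [apply IH; now left | apply IHps; intros q Hq; apply IH; now right].
Qed.

(** In the lemmas below the entries of the list are the values of the variables
    a, b, c, a', b', s, e of [rule]. *)
Definition env (xs : list nat) (i : nat) : nat := nth i xs 0.

Lemma derives_rule r xs :
  fold_right (fun p => and (derives program (peval (env xs) p))) True
    (premises (rule r)) ->
  derives program (peval (env xs) (conclusion (rule r))).
Proof.
  intros H. apply derives_clause; [apply rule_in_program|].
  induction (premises (rule r)) as [|q ps IHps]; intros p Hp; [destruct Hp|].
  destruct H as [Hq H], Hp as [<-|Hp]; auto.
Qed.

Ltac by_rule r xs :=
  pose proof (derives_rule r xs) as Hrule;
  cbn -[program quote pmem_W nth peano_axioms to_nat] in Hrule;
  rewrite ?peval_quote_closed in Hrule;
  cbn [env nth] in Hrule;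
  apply Hrule; clear Hrule; repeat split.

Lemma derives_term t : derives program (npair 0 (godel_term t)).
Proof.
  induction t; cbn [godel_term].
  - by_rule term_var [n].
  - by_rule term_zero (@nil nat).
  - by_rule term_succ [godel_term t]; assumption.
  - by_rule term_plus [godel_term t1; godel_term t2]; assumption.
  - by_rule term_mult [godel_term t1; godel_term t2]; assumption.
Qed.

Lemma derives_formula phi : derives program (npair 1 (godel phi)).
Proof.
  induction phi; cbn [godel].
  - by_rule formula_bot (@nil nat).
  - by_rule formula_equal [godel_term s; godel_term t]; apply derives_term.
  - by_rule formula_imp [godel phi1; godel phi2]; assumption.
  - by_rule formula_all [godel phi]; assumption.
  - by_rule formula_know [godel phi]; assumption.
Qed.

Lemma derives_numeral n :
  derives program (npair 2 (npair n (godel_term (numeral n)))).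
Proof.
  induction n; cbn [godel_term numeral].
  - by_rule numeral_zero (@nil nat).
  - by_rule numeral_succ [n; godel_term (numeral n)]; assumption.
Qed.

(** Stated for one substitution, because for [Up s] the values at variables are
    obtained by applying [Shift] to terms. *)
Lemma derives_subst_term_aux s :
  (forall n, derives program
     (npair 3 (npair (godel_sname s) (npair n (godel_term (sval s n)))))) ->
  forall t, derives program
    (npair 4 (npair (godel_sname s)
      (npair (godel_term t) (godel_term (subst_term (sval s) t))))).
Proof.
  intros Hs t. set (k := godel_sname s) in *.
  induction t; cbn [godel_term subst_term].
  - by_rule subst_var [n; godel_term (sval s n); 0; 0; 0; k]; apply Hs.
  - by_rule subst_zero [0; 0; 0; 0; 0; k].
  - by_rule subst_succ [godel_term t; 0; 0;
      godel_term (subst_term (sval s) t); 0; k]; assumption.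
  - by_rule subst_plus [godel_term t1; godel_term t2; 0;
      godel_term (subst_term (sval s) t1);
      godel_term (subst_term (sval s) t2); k]; assumption.
  - by_rule subst_mult [godel_term t1; godel_term t2; 0;
      godel_term (subst_term (sval s) t1);
      godel_term (subst_term (sval s) t2); k]; assumption.
Qed.

Lemma derives_var s n :
  derives program
    (npair 3 (npair (godel_sname s) (npair n (godel_term (sval s n))))).
Proof.
  assert (Hshift : forall n, derives program
    (npair 3 (npair (godel_sname Shift)
      (npair n (godel_term (sval Shift n)))))).
  { intros m. by_rule var_shift [m]. }
  revert n. induction s as [|t| |s IH]; [exact Hshift|..];
    intros [|n]; cbn [godel_sname sval inst scons up godel_term].
  - by_rule var_inst_0 [godel_term t].
  - by_rule var_inst_S [godel_term t; n].
  - by_rule var_next_0 (@nil nat).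
  - by_rule var_next_S [n].
  - by_rule var_up_0 [0; 0; 0; 0; 0; godel_sname s].
  - by_rule var_up_S [n; godel_term (sval s n);
      godel_term (subst_term shift (sval s n)); 0; 0; godel_sname s].
    + apply IH.
    + apply (derives_subst_term_aux Shift Hshift).
Qed.

Lemma derives_subst_term s t :
  derives program
    (npair 4 (npair (godel_sname s)
      (npair (godel_term t) (godel_term (subst_term (sval s) t))))).
Proof. apply derives_subst_term_aux, derives_var. Qed.

Lemma derives_subst s phi :
  derives program
    (npair 5 (npair (godel_sname s)
      (npair (godel phi) (godel (subst (sval s) phi))))).
Proof.
  revert s. induction phi as [|t u|phi IH1 psi IH2|phi IH|phi _]; intros s;
    cbn [godel subst].
  - by_rule subst_bot [0; 0; 0; 0; 0; godel_sname s].
  - by_rule subst_equal [godel_term t; godel_term u; 0;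
      godel_term (subst_term (sval s) t);
      godel_term (subst_term (sval s) u); godel_sname s];
      apply derives_subst_term.
  - by_rule subst_imp [godel phi; godel psi; 0; godel (subst (sval s) phi);
      godel (subst (sval s) psi); godel_sname s]; auto.
  - by_rule subst_all [godel phi; 0; 0; godel (subst (up (sval s)) phi); 0;
      godel_sname s]; apply (IH (Up s)).
  - by_rule subst_know [godel phi; 0; 0; 0; 0; godel_sname s].
    apply derives_formula.
Qed.

Lemma derives_knows e phi :
  knows e phi -> derives program (npair 6 (npair e (godel phi))).
Proof.
  induction 1 as [phi Hphi|phi psi _ IH1 _ IH2|phi _ IH|phi _ IH|phi Hphi
                 |phi|phi psi|phi].
  - destruct Hphi; cbn [godel Neg].
    + by_rule rule_K [godel phi; godel psi; 0; 0; 0; 0; e];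
        apply derives_formula.
    + by_rule rule_S [godel phi; godel psi; godel chi; 0; 0; 0; e];
        apply derives_formula.
    + by_rule rule_dne [godel phi; 0; 0; 0; 0; 0; e]; apply derives_formula.
    + by_rule rule_all_imp [godel phi; godel psi; 0; 0; 0; 0; e];
        apply derives_formula.
    + by_rule rule_all_intro [godel phi; 0; 0; godel (subst shift phi); 0; 0; e].
      apply (derives_subst Shift).
    + by_rule rule_all_elim [godel phi; godel_term t; 0;
        godel (subst (inst t) phi); 0; 0; e].
      * apply derives_term.
      * apply (derives_subst (Inst t)).
    + by_rule rule_refl [godel_term t; 0; 0; 0; 0; 0; e]; apply derives_term.
    + by_rule rule_leibniz [godel phi; godel_term s; godel_term t;
        godel (subst (inst s) phi); godel (subst (inst t) phi); 0; e].
      * apply derives_term.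
      * apply derives_term.
      * apply (derives_subst (Inst s)).
      * apply (derives_subst (Inst t)).
  - by_rule rule_mp [godel phi; godel psi; 0; 0; 0; 0; e];
      auto using derives_formula.
  - by_rule rule_gen [godel phi; 0; 0; 0; 0; 0; e]; assumption.
  - by_rule rule_know [godel phi; 0; 0; 0; 0; 0; e]; assumption.
  - pose (xs := [0; 0; 0; 0; 0; 0; e]).
    destruct Hphi as [<-|[<-|[<-|[<-|[<-|[<-|[]]]]]]].
    + by_rule rule_peano_0 xs.
    + by_rule rule_peano_1 xs.
    + by_rule rule_peano_2 xs.
    + by_rule rule_peano_3 xs.
    + by_rule rule_peano_4 xs.
    + by_rule rule_peano_5 xs.
  - unfold induction. cbn [godel].
    by_rule rule_induction [godel phi; 0; 0; godel (subst (inst Zero) phi);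
      godel (subst (sval Next) phi); 0; e].
    + apply (derives_subst (Inst Zero)).
    + apply (derives_subst Next).
  - by_rule rule_know_mp [godel phi; godel psi; 0; 0; 0; 0; e];
      apply derives_formula.
  - cbn [godel Iff And Neg].
    set (xs := [godel phi; godel_term (numeral e);
                godel_term (numeral (godel phi)); 0; 0; 0; e]).
    assert (E : peval (env xs) (pmem_W (PVar 1) (PVar 2))
                = godel (mem_W e (godel phi))).
    { apply peval_pmem_W; reflexivity. }
    assert (E6 : env xs 6 = e) by reflexivity.
    assert (E0 : env xs 0 = godel phi) by reflexivity.
    assert (E1 : env xs 1 = godel_term (numeral e)) by reflexivity.
    assert (E2 : env xs 2 = godel_term (numeral (godel phi))) by reflexivity.
    clearbody xs. pose proof (derives_rule rule_index xs) as H.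
    cbn -[program pmem_W env to_nat] in H.
    rewrite E, E0, E1, E2, E6 in H. apply H.
    auto using derives_formula, derives_numeral.
Qed.

Theorem derives_knows_iff e n :
  derives program (npair 6 (npair e n)) <->
  exists phi, n = godel phi /\ knows e phi.
Proof.
  split.
  - intros H%derives_sound. rewrite holds_npair in H.
    destruct H as (e' & phi & E & H). apply npair_inj in E as [-> ->]. eauto.
  - intros (phi & -> & H). now apply derives_knows.
Qed.

(** * Gödel's beta function *)

Definition beta (a b i : nat) : nat := a mod S (S i * b).

Lemma coprime_mult a b c :
  Nat.gcd a c = 1 -> Nat.gcd b c = 1 -> Nat.gcd (a * b) c = 1.
Proof.
  intros Ha Hb. set (g := Nat.gcd (a * b) c).
  assert (Hgc : Nat.divide g c) by apply Nat.gcd_divide_r.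
  apply Nat.divide_1_r. rewrite <- Hb. apply Nat.gcd_greatest; [|exact Hgc].
  apply Nat.gauss with a; [apply Nat.gcd_divide_l|].
  apply Nat.divide_1_r. rewrite <- Ha. apply Nat.gcd_greatest.
  - apply Nat.gcd_divide_r.
  - etransitivity; [apply Nat.gcd_divide_l | exact Hgc].
Qed.

(** With a Bézout identity u M = 1 + v m, a multiple of u M corrects the residue
    modulo [m]; the term a (m - 1) stands for -a. *)
Lemma chinese_remainder_step a M m r :
  M <> 0 -> r < m -> Nat.gcd M m = 1 -> exists t, (a + t * M) mod m = r.
Proof.
  intros HM Hr Hg.
  destruct (Nat.gcd_bezout_pos M m) as (u & v & E); [lia|]. rewrite Hg in E.
  exists (u * (r + a * (m - 1))).
  replace (a + u * (r + a * (m - 1)) * M)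
    with (r + (a + v * (r + a * (m - 1))) * m).
  - rewrite Nat.Div0.mod_add. now apply Nat.mod_small.
  - replace (u * (r + a * (m - 1)) * M)
      with ((1 + v * m) * (r + a * (m - 1))) by (rewrite <- E; ring).
    destruct m as [|m]; [lia|]. replace (S m - 1) with m by lia. ring.
Qed.

(** The induction carries a common multiple [M] of the moduli treated so far that
    is coprime to the remaining ones. *)
Lemma chinese_remainder (m s : nat -> nat) (n : nat) :
  (forall i, i < n -> s i < m i) ->
  (forall i j, i < j -> j < n -> Nat.gcd (m i) (m j) = 1) ->
  exists a, forall i, i < n -> a mod m i = s i.
Proof.
  intros Hs Hm.
  cut (forall k, k <= n -> exists a M, M <> 0 /\
         (forall i, i < k -> a mod m i = s i /\ Nat.divide (m i) M) /\
         (forall j, k <= j -> j < n -> Nat.gcd M (m j) = 1)).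
  { intros H. destruct (H n (le_n n)) as (a & M & _ & Ha & _). exists a.
    intros i Hi. now apply Ha. }
  induction k as [|k IH]; intros Hk.
  - exists 0, 1. split; [lia|]. split; [lia | reflexivity].
  - destruct IH as (a & M & HM & Ha & Hcop); [lia|].
    destruct (chinese_remainder_step a M (m k) (s k)) as [t Ht]; auto.
    exists (a + t * M), (M * m k). split; [|split].
    + specialize (Hs k). nia.
    + intros i Hi. destruct (Nat.eq_dec i k) as [->|].
      * split; [exact Ht | now apply Nat.divide_factor_r].
      * destruct (Ha i) as [Hai [q ->]]; [lia|]. split.
        -- rewrite Nat.mul_assoc. now rewrite Nat.Div0.mod_add.
        -- exists (q * m k). ring.
    + intros j Hj Hjn. apply coprime_mult; [apply Hcop; lia | apply Hm; lia].
Qed.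

Lemma divide_fact k n : 0 < k -> k <= n -> Nat.divide k (fact n).
Proof.
  intros Hk. induction 1 as [|n _ IH].
  - destruct k; [lia|]. simpl fact. exists (fact k). simpl. ring.
  - simpl fact. destruct IH as [q ->]. exists (S n * q). simpl. ring.
Qed.

(** Gödel's choice b = N!, with N bounding both the length and the entries, makes
    the moduli 1 + (i + 1) b pairwise coprime and large enough. *)
Lemma beta_surjective (s : nat -> nat) (n : nat) :
  exists a b, forall i, i < n -> beta a b i = s i.
Proof.
  set (N := n + list_max (map s (seq 0 n))).
  assert (HN : forall i, i < n -> s i <= N).
  { intros i Hi. pose proof (proj1 (list_max_le (map s (seq 0 n)) _) (le_n _)) as H.
    rewrite Forall_forall in H. transitivity (list_max (map s (seq 0 n))).
    - apply H, in_map, in_seq. lia.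
    - unfold N. lia. }
  destruct (chinese_remainder (fun i => S (S i * fact N)) s n) as [a Ha].
  - intros i Hi. specialize (HN i Hi).
    assert (N <= fact N).
    { destruct N as [|N']; [lia|]. simpl. pose proof (lt_O_fact N'). nia. }
    nia.
  - (* A common divisor divides (j + 1) m_i - (i + 1) m_j = j - i, hence N!. *)
    intros i j Hij Hj. set (g := Nat.gcd _ _).
    assert (Hi : Nat.divide g (S (S i * fact N))) by apply Nat.gcd_divide_l.
    assert (Hj' : Nat.divide g (S (S j * fact N))) by apply Nat.gcd_divide_r.
    assert (Hd : Nat.divide g (j - i)).
    { replace (j - i) with (S j * S (S i * fact N) - S i * S (S j * fact N)) by nia.
      apply Nat.divide_sub_r; now apply Nat.divide_mul_r. }
    apply Nat.divide_1_r.
    replace 1 with (S (S i * fact N) - S i * fact N) by lia.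
    apply Nat.divide_sub_r; [exact Hi|]. apply Nat.divide_mul_r.
    etransitivity; [exact Hd|]. apply divide_fact; unfold N; lia.
  - exists a, (fact N). exact Ha.
Qed.

(** * Truth of the arithmetized formulas *)

Section Truth.

Context (KI : formula -> Prop) (rho : nat -> nat).
Let M := arith_structure KI.

Fixpoint push (xs : list nat) : nat -> nat :=
  match xs with
  | [] => rho
  | x :: xs => scons x (push xs)
  end.

(** [xs] lists the values of the bound variables, innermost first.  The further
    quantifiers [ys] make the notion stable under weakening, so that no index
    ever has to be computed. *)
Definition denotes (xs : list nat) (t : dterm) (v : nat) : Prop :=
  forall ys, eval_term M (push (ys ++ xs)) (t (length (ys ++ xs))) = v.

Definition true_at (xs : list nat) (A : dformula) : Prop :=
  sat M (push xs) (A (length xs)).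

Lemma denotes_weaken x xs t v : denotes xs t v -> denotes (x :: xs) t v.
Proof.
  intros H ys. replace (ys ++ x :: xs) with ((ys ++ [x]) ++ xs); [apply H|].
  now rewrite <- app_assoc.
Qed.

Lemma denotes_bound x xs :
  denotes (x :: xs) (fun d => Var (d - S (length xs))) x.
Proof.
  intros ys. cbn. replace (length (ys ++ x :: xs) - S (length xs)) with (length ys).
  - induction ys as [|y ys IH]; [reflexivity | exact IH].
  - rewrite length_app. simpl. lia.
Qed.

Lemma denotes_numeral xs n : denotes xs (dnumeral n) n.
Proof.
  intros ys. unfold dnumeral. induction n; simpl; [reflexivity | now rewrite IHn].
Qed.

Lemma denotes_succ xs t v : denotes xs t v -> denotes xs (dsucc t) (S v).
Proof. intros H ys. cbn. now rewrite H. Qed.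

Lemma denotes_plus xs s t u v :
  denotes xs s u -> denotes xs t v -> denotes xs (dplus s t) (u + v).
Proof. intros Hs Ht ys. cbn. now rewrite Hs, Ht. Qed.

Lemma denotes_mult xs s t u v :
  denotes xs s u -> denotes xs t v -> denotes xs (dmult s t) (u * v).
Proof. intros Hs Ht ys. cbn. now rewrite Hs, Ht. Qed.

Lemma true_deq xs s t u v :
  denotes xs s u -> denotes xs t v -> (true_at xs (deq s t) <-> u = v).
Proof.
  intros Hs Ht. unfold true_at, deq. cbn [sat].
  specialize (Hs []). specialize (Ht []). cbn [app] in Hs, Ht.
  now rewrite Hs, Ht.
Qed.

Lemma true_dand xs A B P Q :
  (true_at xs A <-> P) -> (true_at xs B <-> Q) ->
  (true_at xs (dand A B) <-> P /\ Q).
Proof. unfold true_at, dand. cbn. tauto. Qed.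

Lemma true_dor xs A B P Q :
  (true_at xs A <-> P) -> (true_at xs B <-> Q) ->
  (true_at xs (dor A B) <-> P \/ Q).
Proof. unfold true_at, dor. cbn. tauto. Qed.

Lemma true_dimp xs A B (P Q : Prop) :
  (true_at xs A <-> P) -> (true_at xs B <-> Q) ->
  (true_at xs (dimp A B) <-> (P -> Q)).
Proof. unfold true_at, dimp. cbn. tauto. Qed.

Lemma true_dall xs F (P : nat -> Prop) :
  (forall x t, denotes (x :: xs) t x -> (true_at (x :: xs) (F t) <-> P x)) ->
  (true_at xs (dall F) <-> forall x, P x).
Proof.
  intros H. split; intros Hx x.
  - apply (H x _ (denotes_bound x xs)), Hx.
  - apply (H x _ (denotes_bound x xs)), Hx.
Qed.

Lemma true_dex xs F (P : nat -> Prop) :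
  (forall x t, denotes (x :: xs) t x -> (true_at (x :: xs) (F t) <-> P x)) ->
  (true_at xs (dex F) <-> exists x, P x).
Proof.
  intros H. split.
  - intros Hx. apply NNPP. intros Hn. apply Hx. intros x Hs.
    apply Hn. exists x. now apply (H x _ (denotes_bound x xs)).
  - intros [x Hx] Hn. apply (Hn x), (H x _ (denotes_bound x xs)), Hx.
Qed.

Ltac denote :=
  first
    [ eassumption
    | apply denotes_numeral
    | apply denotes_succ; denote
    | apply denotes_plus; denote
    | apply denotes_mult; denote
    | apply denotes_weaken; denote ].

Lemma true_dlt xs s t u v :
  denotes xs s u -> denotes xs t v -> (true_at xs (dlt s t) <-> u < v).
Proof.
  intros Hs Ht. transitivity (exists z, S (u + z) = v).
  - apply true_dex. intros z r Hz. apply true_deq; denote.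
  - split; [intros [z <-]; lia | intros H; exists (v - S u); lia].
Qed.

Lemma true_dpair xs s t r x y p :
  denotes xs s x -> denotes xs t y -> denotes xs r p ->
  (true_at xs (dpair s t r) <-> npair x y = p).
Proof.
  intros Hs Ht Hr. transitivity (p + p = (x + y) * S (x + y) + (y + y)).
  - apply true_deq; denote.
  - pose proof (to_nat_spec x y) as E. rewrite (Nat.add_comm y x) in E. lia.
Qed.

Lemma true_dbeta xs s t r q a b i v :
  denotes xs s a -> denotes xs t b -> denotes xs r i -> denotes xs q v ->
  (true_at xs (dbeta s t r q) <-> beta a b i = v).
Proof.
  intros Hs Ht Hr Hq.
  transitivity (v < S (S i * b) /\ exists k, a = k * S (S i * b) + v).
  - apply true_dand; [apply true_dlt; denote|].
    apply true_dex. intros k z Hk. apply true_deq; denote.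
  - unfold beta. split.
    + intros [Hv [k ->]]. rewrite Nat.add_comm, Nat.Div0.mod_add.
      now apply Nat.mod_small.
    + intros <-. split; [apply Nat.mod_upper_bound; lia|].
      exists (a / S (S i * b)). rewrite Nat.mul_comm. apply Nat.div_mod_eq.
Qed.

Lemma true_ditem xs ta tb ti tc tx ty a b i c x y :
  denotes xs ta a -> denotes xs tb b -> denotes xs ti i ->
  denotes xs tc c -> denotes xs tx x -> denotes xs ty y ->
  (true_at xs (ditem ta tb ti tc tx ty)
   <-> beta a b i = npair c (npair x y)).
Proof.
  intros. transitivity
    (exists q p, npair x y = q /\ npair c q = p /\ beta a b i = p).
  - apply true_dex; intros q tq Hq. apply true_dex; intros p tp Hp.
    repeat apply true_dand; [apply true_dpair|apply true_dpair|apply true_dbeta];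
      denote.
  - split; [intros (q & p & <- & <- & E); exact E | eauto 6].
Qed.

Lemma true_dearlier xs ta tb ti tc tx ty a b i c x y :
  denotes xs ta a -> denotes xs tb b -> denotes xs ti i ->
  denotes xs tc c -> denotes xs tx x -> denotes xs ty y ->
  (true_at xs (dearlier ta tb ti tc tx ty)
   <-> exists j, j < i /\ beta a b j = npair c (npair x y)).
Proof.
  intros. apply true_dex; intros j tj Hj.
  apply true_dand; [apply true_dlt | apply true_ditem]; denote.
Qed.

Lemma true_dtag xs tp tc k p c :
  denotes xs tp p -> denotes xs tc c ->
  (true_at xs (dtag k tp tc) <-> c = k + 4 * p).
Proof. intros. apply true_deq; denote. Qed.

(** The arithmetical content of [dstep], disjunct by disjunct. *)
Definition step (P : nat -> nat -> nat -> Prop) (c x y : nat) : Prop :=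
  (c = 0 /\ y = 0) \/
  (c = 1 /\ y = S x) \/
  (c = 2 /\ exists b, npair y b = x) \/
  (c = 3 /\ exists a, npair a y = x) \/
  (exists f g p, npair f g = p /\ c = 4 + 4 * p /\
     exists u v, P f x u /\ P g x v /\ npair u v = y) \/
  (exists f g p, npair f g = p /\ c = 5 + 4 * p /\
     exists u, P g x u /\ P f u y) \/
  (exists f g p, npair f g = p /\ c = 6 + 4 * p /\
     exists a, npair a 0 = x /\ P f a y) \/
  (exists f g p, npair f g = p /\ c = 6 + 4 * p /\
     exists a n u w nu z, npair a (S n) = x /\
       npair a n = w /\ P c w u /\
       npair n u = nu /\ npair a nu = z /\ P g z y) \/
  (exists f, c = 7 + 4 * f /\
     exists a, npair a y = x /\ P f x 0) \/
  (exists f, c = 7 + 4 * f /\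
     exists a m k w, npair a m = x /\ P f x (S k) /\
       npair a (S m) = w /\ P c w y).

(** [dstep] takes a formula with three arguments as a parameter and uses it below
    various numbers of quantifiers. *)
Definition expresses (xs : list nat) (P : dterm -> dterm -> dterm -> dformula)
    (Q : nat -> nat -> nat -> Prop) : Prop :=
  forall tc tx ty c x y,
    denotes xs tc c -> denotes xs tx x -> denotes xs ty y ->
    (true_at xs (P tc tx ty) <-> Q c x y).

Lemma true_dstep xs P Q tc tx ty c x y :
  (forall ys, expresses (ys ++ xs) P Q) ->
  denotes xs tc c -> denotes xs tx x -> denotes xs ty y ->
  (true_at xs (dstep P tc tx ty) <-> step Q c x y).
Proof.
  intros HP Hc Hx Hy.
  (* The lists have the numbers of quantifiers above the uses of [P]. *)
  repeat
    (first
      [ apply true_dor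
      | apply true_dand
      | apply true_dex; intros ? ? ?
      | apply true_dpair; denote
      | apply true_dtag; denote
      | apply true_deq; denote
      | apply (HP [_; _; _; _; _; _; _; _; _]); denote
      | apply (HP [_; _; _; _; _]); denote
      | apply (HP [_; _; _; _]); denote
      | apply (HP [_; _]); denote ]).
Qed.

Definition computation (a b l e n y : nat) : Prop :=
  beta a b l = npair e (npair n y) /\
  forall i, i < S l -> exists c x z,
    beta a b i = npair c (npair x z) /\
    step (fun c x z => exists j, j < i /\ beta a b j = npair c (npair x z))
      c x z.

Lemma sat_mem_W e n :
  sat M rho (mem_W e n) <-> exists a b l y, computation a b l e n y.
Proof.
  change (sat M rho (mem_W e n)) with (true_at [] (fun _ => mem_W e n)).
  apply true_dex; intros a ta Ha. apply true_dex; intros b tb Hb.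
  apply true_dex; intros l tl Hl. apply true_dex; intros y ty Hy.
  apply true_dand; [apply true_ditem; denote|].
  apply true_dall; intros i ti Hi.
  apply true_dimp; [apply true_dlt; denote|].
  apply true_dex; intros c tc Hc. apply true_dex; intros x tx Hx.
  apply true_dex; intros z tz Hz.
  apply true_dand; [apply true_ditem; denote|].
  apply true_dstep; [|denote..].
  intros ys tc' tx' ty' c' x' y' Hc' Hx' Hy'.
  apply true_dearlier; try assumption;
    clear Hc' Hx' Hy'; induction ys as [|v ys IH]; simpl;
    first [apply denotes_weaken; exact IH | denote].
Qed.

End Truth.

(** * Computations and evaluation *)

Lemma step_mono (P Q : nat -> nat -> nat -> Prop) c x y :
  (forall c x y, P c x y -> Q c x y) -> step P c x y -> step Q c x y.
Proof.
  intros H. unfold step.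
  repeat match goal with
  | |- _ \/ _ -> _ =>
      let h := fresh in intros [h|h]; [left|right]; revert h
  | |- _ /\ _ -> _ =>
      let h := fresh in let h' := fresh in
      intros [h h']; split; [revert h; clear h' | revert h'; clear h]
  | |- (exists _, _) -> _ =>
      let v := fresh in let h := fresh in intros [v h]; exists v; revert h
  end; auto.
Qed.

(** The arithmetized rules quantify over numbers, so a subcode that they mention
    without evaluating it has to be recovered from its number. *)
Lemma code_num_surj n : exists c, code_num c = n.
Proof.
  induction n as [n IH] using lt_wf_ind.
  destruct (Nat.lt_ge_cases n 4) as [Hn|Hn].
  - destruct n as [|[|[|[|n]]]];
      [exists CZero|exists CSucc|exists CLeft|exists CRight|lia]; reflexivity.
  - pose proof (Nat.div_mod_eq (n - 4) 4) as E.
    pose proof (Nat.mod_upper_bound (n - 4) 4 ltac:(lia)) as Hr.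
    set (m := (n - 4) / 4) in *. set (r := (n - 4) mod 4) in *.
    destruct (proj_le m) as [H1 H2].
    destruct (IH (pfst m)) as [f Hf]; [lia|].
    destruct (IH (psnd m)) as [g Hg]; [lia|].
    destruct (IH m) as [h Hh]; [lia|].
    assert (Hp : npair (code_num f) (code_num g) = m)
      by (rewrite Hf, Hg; apply npair_proj).
    destruct r as [|[|[|[|r]]]];
      [exists (CPair f g)|exists (CComp f g)|exists (CPrec f g)
      |exists (CFind h)|lia];
      cbn -[Nat.mul]; rewrite ?Hp, ?Hh; lia.
Qed.

Definition runs (c x y : nat) : Prop :=
  exists k, code_num k = c /\ eval k x y.

Lemma runs_code_num k x y : runs (code_num k) x y <-> eval k x y.
Proof.
  split; [|now exists k]. intros (k' & E & H). now apply code_num_inj in E as <-.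
Qed.

Lemma step_runs c x y : step runs c x y -> runs c x y.
Proof.
  unfold step. intros H.
  repeat match goal with
  | H : _ \/ _ |- _ => destruct H as [H|H]
  | H : exists f, _ = 7 + 4 * f /\ _ |- _ =>
      destruct H as (f & Hc & H); destruct (code_num_surj f) as [kf <-]
  | H : exists f g p, _ |- _ =>
      destruct H as (f & g & p & <- & Hc & H);
      destruct (code_num_surj f) as [kf <-]; destruct (code_num_surj g) as [kg <-]
  end.
  - destruct H as [-> ->]. exists CZero. split; [reflexivity | constructor].
  - destruct H as [-> ->]. exists CSucc. split; [reflexivity | constructor].
  - destruct H as [-> [b <-]]. exists CLeft. split; [reflexivity | constructor].
  - destruct H as [-> [a <-]]. exists CRight. split; [reflexivity | constructor].
  - destruct H as (u & v & Hu & Hv & <-). rewrite runs_code_num in *.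
    exists (CPair kf kg). split; [easy | now constructor].
  - destruct H as (u & Hu & Hv). rewrite runs_code_num in *.
    exists (CComp kf kg). split; [easy | now apply eval_comp with u].
  - destruct H as (a & <- & H). rewrite runs_code_num in *.
    exists (CPrec kf kg). split; [easy | now constructor].
  - destruct H as (a & n & u & w & nu & z & <- & <- & Hu & <- & <- & H).
    change (6 + 4 * _) with (code_num (CPrec kf kg)) in Hc. subst c.
    rewrite runs_code_num in *. now apply eval_prec_S with u.
  - destruct H as (a & <- & H). rewrite runs_code_num in *.
    exists (CFind kf). split; [easy | now constructor].
  - destruct H as (a & m & k & w & <- & H & <- & Hn).
    change (7 + 4 * _) with (code_num (CFind kf)) in Hc. subst c.
    rewrite runs_code_num in *. now apply eval_find_next with k.
Qed.

(** A computation before it is coded by the beta function. *)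
Definition justified (K : list (nat * nat * nat)) : Prop :=
  forall i c x y, nth_error K i = Some (c, x, y) ->
    step (fun c x y => exists j, j < i /\ nth_error K j = Some (c, x, y)) c x y.

Lemma justified_app K L : justified K -> justified L -> justified (K ++ L).
Proof.
  intros HK HL i c x y H. destruct (Nat.lt_ge_cases i (length K)) as [Hi|Hi].
  - rewrite nth_error_app1 in H by assumption. apply HK in H.
    eapply step_mono; [|exact H]. intros c' x' y' (j & Hj & E). exists j.
    split; [assumption|]. rewrite nth_error_app1; [assumption | lia].
  - rewrite nth_error_app2 in H by assumption. apply HL in H.
    eapply step_mono; [|exact H]. intros c' x' y' (j & Hj & E).
    exists (j + length K). split; [lia|].
    rewrite nth_error_app2 by lia. now replace (j + length K - length K) with j by lia.
Qed.

Lemma justified_close K c x y :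
  justified K -> step (fun c x y => In (c, x, y) K) c x y ->
  exists L, justified L /\ In (c, x, y) L.
Proof.
  intros HK Hs. exists (K ++ [(c, x, y)]).
  split; [|apply in_or_app; right; now left].
  intros i c' x' y' H. destruct (Nat.lt_ge_cases i (length K)) as [Hi|Hi].
  - rewrite nth_error_app1 in H by assumption. apply HK in H.
    eapply step_mono; [|exact H]. intros c1 x1 y1 (j & Hj & E). exists j.
    split; [assumption|]. rewrite nth_error_app1; [assumption | lia].
  - rewrite nth_error_app2 in H by assumption.
    destruct (i - length K) as [|k]; [|now destruct k].
    injection H as <- <- <-. eapply step_mono; [|exact Hs].
    intros c1 x1 y1 [j E]%In_nth_error. exists j.
    assert (j < length K) by (apply nth_error_Some; congruence).
    split; [lia|]. now rewrite nth_error_app1.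
Qed.

Lemma justified_join p q :
  (exists K, justified K /\ In p K) -> (exists K, justified K /\ In q K) ->
  exists K, justified K /\ In p K /\ In q K.
Proof.
  intros (K & HK & Hp) (L & HL & Hq). exists (K ++ L).
  auto using justified_app, in_or_app.
Qed.

Lemma eval_justified k x y :
  eval k x y -> exists K, justified K /\ In (code_num k, x, y) K.
Proof.
  assert (H0 : justified []) by (intros [] ? ? ?; discriminate).
  induction 1 as [x|x|a b|a b|f g x u v _ IHf _ IHg|f g x u y _ IHg _ IHf
    |f g a y _ IH|f g a n u y _ IHn _ IHg|f a m _ IH|f a m r y _ IHf _ IH].
  1-4: apply (justified_close []); [exact H0|];
    unfold step; cbn [code_num]; intuition eauto.
  - destruct (justified_join _ _ IHf IHg) as (K & HK & Hf & Hg).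
    apply (justified_close K); [exact HK|]. unfold step.
    do 4 right; left. repeat eexists; eassumption.
  - destruct (justified_join _ _ IHg IHf) as (K & HK & Hg & Hf).
    apply (justified_close K); [exact HK|]. unfold step.
    do 5 right; left. repeat eexists; eassumption.
  - destruct IH as (K & HK & Hf).
    apply (justified_close K); [exact HK|]. unfold step.
    do 6 right; left. exists (code_num f), (code_num g). repeat eexists; eassumption.
  - destruct (justified_join _ _ IHn IHg) as (K & HK & Hn & Hg).
    apply (justified_close K); [exact HK|]. unfold step.
    do 7 right; left. repeat eexists; eassumption.
  - destruct IH as (K & HK & Hf).
    apply (justified_close K); [exact HK|]. unfold step.
    do 8 right; left. repeat eexists; eassumption.
  - destruct (justified_join _ _ IHf IH) as (K & HK & Hf & Hn).
    apply (justified_close K); [exact HK|]. unfold step.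
    do 9 right. repeat eexists; eassumption.
Qed.

(** By strong induction every item of the sequence is a true evaluation. *)
Lemma computation_runs a b l e n y : computation a b l e n y -> runs e n y.
Proof.
  intros [Hl Hstep].
  cut (forall i c x z, i < S l -> beta a b i = npair c (npair x z) -> runs c x z).
  { intros H. apply (H l); auto. }
  induction i as [i IH] using lt_wf_ind. intros c x z Hi Hb.
  destruct (Hstep i Hi) as (c' & x' & z' & Hb' & Hs). rewrite Hb in Hb'.
  apply npair_inj in Hb' as [<- Hb']. apply npair_inj in Hb' as [<- <-].
  apply step_runs. eapply step_mono; [|exact Hs].
  intros c' x' z' (j & Hj & E). apply (IH j); auto. lia.
Qed.

Lemma runs_computation e n y :
  runs e n y -> exists a b l, computation a b l e n y.
Proof.
  intros (k & <- & H). apply eval_justified in H as (K & HK & [l Hl]%In_nth_error).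
  destruct (beta_surjective (fun i => match nth_error K i with
              | Some (c, x, z) => npair c (npair x z) | None => 0 end) (S l))
    as (a & b & Hab).
  exists a, b, l. split.
  - now rewrite Hab, Hl by lia.
  - intros i Hi.
    assert (l < length K) by (apply nth_error_Some; congruence).
    destruct (nth_error K i) as [[[c x] z]|] eqn:Ei.
    2: { apply nth_error_None in Ei. lia. }
    exists c, x, z. split; [now rewrite Hab, Ei|].
    eapply step_mono; [|exact (HK i c x z Ei)].
    intros c' x' z' (j & Hj & E). exists j. split; [exact Hj|].
    now rewrite Hab, E by lia.
Qed.

Theorem mem_W_correct KI (rho : nat -> nat) e n :
  sat (arith_structure KI) rho (mem_W e n) <-> W e n.
Proof.
  rewrite sat_mem_W. split.
  - intros (a & b & l & y & H).
    destruct (computation_runs _ _ _ _ _ _ H) as (c & Hc & Hy).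
    exists c. eauto.
  - intros (c & Hc & y & Hy).
    destruct (runs_computation e n y) as (a & b & l & H); [now exists c|].
    now exists a, b, l, y.
Qed.

(** * The knowing machine *)

Lemma index_exists :
  exists e, forall n, W e n <-> exists phi, n = godel phi /\ knows e phi.
Proof.
  destruct (recursion_theorem (fun z => derives program (npair 6 z))) as [e He].
  { apply semidecidable_preimage; [apply semidecidable_derives|].
    auto with computable. }
  exists e. intros n. rewrite He. apply derives_knows_iff.
Qed.

Lemma logical_axiom_valid phi : logical_axiom phi -> valid phi.
Proof.
  intros H M rho. destruct H; cbn [sat Neg].
  - tauto.
  - tauto.
  - apply NNPP.
  - auto.
  - intros H x. apply sat_subst. exact H.
  - intros H. apply sat_subst. eapply sat_ext; [|apply (H (eval_term M rho t))].
    now intros [|n].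
  - reflexivity.
  - intros E H. apply sat_subst. apply sat_subst in H.
    eapply sat_ext; [|exact H]. now intros [|n].
Qed.

Lemma provable_knows e phi : provable phi -> knows e phi.
Proof. induction 1; eauto using knows. Qed.

Lemma valid_knows e phi : valid phi -> knows e phi.
Proof. intros H. now apply provable_knows, completeness. Qed.

Lemma PA_knows e phi : PA phi -> knows e phi.
Proof.
  intros [| | | | | |k psi _]; try (apply knows_peano; simpl; tauto).
  induction k; simpl; [apply knows_induction | now apply knows_gen].
Qed.

Lemma basic_axiom_knows e phi : basic_axiom phi -> knows e phi.
Proof.
  intros [psi H|psi chi|psi H].
  - now apply knows_know, valid_knows.
  - apply knows_know_mp.
  - now apply knows_know, PA_knows.
Qed.

Lemma models_induction KI phi : models (arith_structure KI) (induction phi).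
Proof.
  intros rho. unfold induction. cbn [sat]. intros H0 HS x.
  induction x as [|x IH].
  - apply sat_subst in H0. eapply sat_ext; [|exact H0]. now intros [|n].
  - specialize (HS x IH). apply sat_subst in HS.
    eapply sat_ext; [|exact HS]. now intros [|n].
Qed.

Section Machine.

Context (e : nat).
Context (He : forall n, W e n <-> exists phi, n = godel phi /\ knows e phi).
Let M := arith_structure (knows e).

Lemma W_godel phi : W e (godel phi) <-> knows e phi.
Proof.
  rewrite He. split; [|eauto]. now intros (psi & <-%godel_inj & H).
Qed.

(** Soundness, and at the same time factivity of K in [M]. *)
Lemma knows_true phi : knows e phi -> models M phi.
Proof.
  induction 1 as [phi H|phi psi _ IH1 _ IH2|phi _ IH|phi H _|phi H
                 |phi|phi psi|phi].
  - now apply logical_axiom_valid.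
  - intros rho. apply (IH1 rho), IH2.
  - intros rho x. apply IH.
  - intros rho. exact H.
  - destruct H as [<-|[<-|[<-|[<-|[<-|[<-|[]]]]]]]; intros rho; cbn; lia.
  - apply models_induction.
  - intros rho. cbn. apply knows_mp.
  - intros rho. pose proof (mem_W_correct (knows e) rho e (godel phi)) as H.
    rewrite W_godel in H. fold M in H. cbn [sat Iff And Neg i_know M arith_structure].
    change (i_know M phi) with (knows e phi). tauto.
Qed.

Lemma knowing_axiom_true phi : knowing_axiom phi -> models M phi.
Proof.
  intros [psi H|psi H|psi].
  - now apply knows_true, basic_axiom_knows.
  - intros rho. now apply basic_axiom_knows.
  - intros rho H. now apply knows_true.
Qed.

Lemma Sigma_true phi : Sigma e phi -> models M phi.
Proof.
  intros [psi H|psi].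
  - now apply knowing_axiom_true.
  - intros rho. apply knows_index.
Qed.

Lemma machine_recursively_enumerable :
  recursively_enumerable (fun n => exists phi, n = godel phi /\ models M (Know phi)).
Proof.
  exists e. intros n. rewrite He.
  split; intros (phi & -> & H); exists phi; split; try reflexivity.
  - exact (H (fun _ => 0)).
  - intros rho. exact H.
Qed.

End Machine.

Theorem theorem11 :
  exists e : nat, exists M : structure,
    knowing_machine M /\ models_set M (Sigma e).
Proof.
  destruct index_exists as [e He].
  exists e, (arith_structure (knows e)). split; [split; [split|]|].
  - now exists (knows e).
  - exact (knowing_axiom_true e He).
  - exact (machine_recursively_enumerable e He).
  - exact (Sigma_true e He).
Qed.
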